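(* For each $n\ge2$, there exists a rank $n$ CVHS of type $(1,\dots,1)$ on the unit disk $\mathbb D$ that does not admit a harmonic metric.
   Context: A CVHS (complex variation of Hodge structure) of type $(1,\dots,1)$ on a Riemann surface $X$ with canonical bundle $K_X$ is a Higgs bundle $(E,\theta)$ with $E=L_1\oplus\cdots\oplus L_n$, $L_i$ holomorphic line bundles, and $\theta=\sum_{i=1}^{n-1}\gamma_i$ where each $\gamma_i:L_i\to L_{i+1}\otimes K_X$ is a holomorphic bundle map, not identically zero, and $\theta|_{L_n}=0$. A Hermitian metric $h$ on $E$ is harmonic if $F(\nabla_h)+[\theta,\theta^{*_h}]=0$, where $\nabla_h$ is the Chern connection, $F(\nabla_h)$ its curvature, and $\theta^{*_h}$ the $h$-adjoint of $\theta$. The metric is not required to be diagonal. *)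

(* Defs.v *)
From mathcomp Require Import all_boot all_order all_algebra.
From mathcomp Require Import sesquilinear spectral.
From mathcomp Require Import all_classical all_reals all_analysis.
From mathcomp Require Import complex.

Set Implicit Arguments.
Unset Strict Implicit.
Unset Printing Implicit Defensive.

Import Order.TTheory GRing.Theory Num.Theory.
Import numFieldNormedType.Exports.

Local Open Scope classical_set_scope.
Local Open Scope ring_scope.
Local Open Scope complex_scope.
Local Open Scope sesquilinear_scope.

Section Calculus.
Variable R : realType.
Local Notation C := R[i].

(* [derivable] is taken over the field C, so this is complex
   differentiability. *)
Definition holomorphic_on (U : set C) (f : C -> C) : Prop :=
  forall z, U z -> derivable (f : C^o -> C^o) z 1.

(* Derivatives in a real direction v: differentiate the real and imaginary
   parts of t |-> f (z + t v) in the real variable t. *)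
Definition along (f : C -> C) (v z : C) (t : R) : C := f (z + t%:C * v).

Definition rderivable (v : C) (f : C -> C) (z : C) : Prop :=
  derivable (fun t : R => complex.Re (along f v z t)) 0 1 /\
  derivable (fun t : R => complex.Im (along f v z t)) 0 1.

Definition rderive (v : C) (f : C -> C) (z : C) : C :=
  derive1 (fun t : R => complex.Re (along f v z t)) 0 +i*
  derive1 (fun t : R => complex.Im (along f v z t)) 0.

Fixpoint Ck_on (k : nat) (U : set C) (f : C -> C) : Prop :=
  (forall z, U z -> {for z, continuous (f : C^o -> C^o)}) /\
  if k is k'.+1 then
    [/\ forall z, U z -> rderivable 1 f z /\ rderivable 'i%C f z,
        Ck_on k' U (rderive 1 f) & Ck_on k' U (rderive 'i%C f)]
  else True.

Definition smooth_on (U : set C) (f : C -> C) : Prop :=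
  forall k, Ck_on k U f.

(* d/dz = (d/dx - i d/dy) / 2 and d/dzbar = (d/dx + i d/dy) / 2. *)
Definition dz (f : C -> C) (z : C) : C :=
  (rderive 1 f z - 'i%C * rderive 'i%C f z) / 2.
Definition dzbar (f : C -> C) (z : C) : C :=
  (rderive 1 f z + 'i%C * rderive 'i%C f z) / 2.

Definition mx_dz m n (A : C -> 'M[C]_(m, n)) (z : C) : 'M[C]_(m, n) :=
  \matrix_(i, j) dz (fun w => A w i j) z.
Definition mx_dzbar m n (A : C -> 'M[C]_(m, n)) (z : C) : 'M[C]_(m, n) :=
  \matrix_(i, j) dzbar (fun w => A w i j) z.

Definition mx_holomorphic_on m n (U : set C) (A : C -> 'M[C]_(m, n)) : Prop :=
  forall i j, holomorphic_on U (fun z => A z i j).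
Definition mx_smooth_on m n (U : set C) (A : C -> 'M[C]_(m, n)) : Prop :=
  forall i j, smooth_on U (fun z => A z i j).

End Calculus.

Definition unit_disk (R : realType) : set R[i] := [set z | `|z| < 1].
Arguments unit_disk R _ : clear implicits.

Section Bundles.
Variables (R : realType) (X : set R[i]).
Local Notation C := R[i].

Record open_cover := OpenCover {
  chart_index : Type;
  chart :> chart_index -> set C;
  chart_open : forall a, open (chart a : set C^o);
  chart_cover : \bigcup_a chart a = X }.

(* A holomorphic vector bundle of rank n trivialized over the cover W, given by
   its cocycle: a section has coordinate vectors u_a : chart a -> C^n with
   u_a = transition a b * u_b on overlaps.  Finitely many bundles always have a
   common trivializing cover. *)
Record vector_bundle (W : open_cover) (n : nat) := VectorBundle {
  transition : chart_index W -> chart_index W -> C -> 'M[C]_n;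
  transition_holomorphic : forall a b,
    mx_holomorphic_on (W a `&` W b) (transition a b);
  transition_id : forall a z, W a z -> transition a a z = 1%:M;
  transition_cocycle : forall a b c z, W a z -> W b z -> W c z ->
    transition a b z *m transition b c z = transition a c z }.

Definition line_bundle (W : open_cover) := vector_bundle W 1.

(* Holomorphic bundle maps V1 -> V2 (x) K_X.  On X (an open set of C) the bundle
   K_X is trivialized by the global frame dz, so such a map is given in local
   frames by hom_coef a dz, and K_X contributes no transition function. *)
Record bundle_hom (W : open_cover) (m n : nat)
    (V1 : vector_bundle W m) (V2 : vector_bundle W n) := BundleHom {
  hom_coef : chart_index W -> C -> 'M[C]_(n, m);
  hom_holomorphic : forall a, mx_holomorphic_on (W a) (hom_coef a);
  hom_compat : forall a b z, W a z -> W b z ->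
    hom_coef a z *m transition V1 a b z = transition V2 a b z *m hom_coef b z }.

Definition hom_not_identically_zero (W : open_cover) (m n : nat)
    (V1 : vector_bundle W m) (V2 : vector_bundle W n)
    (phi : bundle_hom V1 V2) : Prop :=
  exists a z, W a z /\ hom_coef phi a z != 0.

(* On a Riemann surface the condition theta /\ theta = 0 is automatic. *)
Record higgs_bundle (n : nat) := HiggsBundle {
  higgs_cover : open_cover;
  higgs_vb : vector_bundle higgs_cover n;
  higgs_field : bundle_hom higgs_vb higgs_vb }.

Section DirectSum.
Variables (W : open_cover) (n : nat) (L : 'I_n -> line_bundle W).

Definition dsum_transition a b z : 'M[C]_n :=
  diag_mx (\row_i transition (L i) a b z 0 0).

Lemma dsum_holomorphic a b :
  mx_holomorphic_on (W a `&` W b) (dsum_transition a b).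
Proof.
move=> i j z Wz; rewrite (_ : (fun _ => _) =
  fun w => transition (L i) a b w 0 0 *+ (i == j)); last first.
  by apply/funext => w; rewrite !mxE.
case: (i == j); first exact: (@transition_holomorphic _ _ (L i) a b 0 0 z Wz).
exact: derivable_cst.
Qed.

Lemma dsum_id a z : W a z -> dsum_transition a a z = 1%:M.
Proof.
move=> Wz; apply/matrixP => i j.
by rewrite !mxE transition_id // mxE eqxx.
Qed.

Lemma dsum_cocycle a b c z : W a z -> W b z -> W c z ->
  dsum_transition a b z *m dsum_transition b c z = dsum_transition a c z.
Proof.
move=> Wa Wb Wc; rewrite mulmx_diag; congr diag_mx; apply/rowP => i.
by rewrite !mxE -(transition_cocycle (L i) Wa Wb Wc) mxE big_ord1.
Qed.

Definition dsum : vector_bundle W n :=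
  VectorBundle dsum_holomorphic dsum_id dsum_cocycle.

End DirectSum.

(* 0-based indices of the source L_k and target L_(k+1) of gamma_k. *)
Lemma ltn_pred_src n (k : 'I_n.-1) : (k < n)%N.
Proof. exact: leq_trans (ltn_ord k) (leq_pred n). Qed.
Lemma ltn_pred_tgt n (k : 'I_n.-1) : (k.+1 < n)%N.
Proof. by rewrite -ltn_predRL. Qed.
Definition src n (k : 'I_n.-1) : 'I_n := Ordinal (ltn_pred_src k).
Definition tgt n (k : 'I_n.-1) : 'I_n := Ordinal (ltn_pred_tgt k).

(* Complex variations of Hodge structure of type (1, ..., 1). *)
Record cvhs (n : nat) := CVHS {
  cvhs_cover : open_cover;
  cvhs_line : 'I_n -> line_bundle cvhs_cover;
  cvhs_gamma : forall k : 'I_n.-1,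
    bundle_hom (cvhs_line (src k)) (cvhs_line (tgt k));
  cvhs_gamma_neq0 : forall k, hom_not_identically_zero (cvhs_gamma k) }.

Section HiggsOfCVHS.
Variables (n : nat) (E : cvhs n).
Local Notation W := (cvhs_cover E).
Local Notation L := (@cvhs_line n E).

(* theta = \sum_k gamma_k; it kills the last line bundle, which is never a
   source. *)
Definition cvhs_theta (a : chart_index W) (z : C) : 'M[C]_n :=
  \sum_(k < n.-1) hom_coef (cvhs_gamma E k) a z 0 0 *: delta_mx (tgt k) (src k).

Lemma cvhs_theta_holomorphic a : mx_holomorphic_on (W a) (cvhs_theta a).
Proof.
move=> i j z Wz; rewrite (_ : (fun _ => _) = \sum_(k < n.-1)
    ((fun w => hom_coef (cvhs_gamma E k) a w 0 0 *
              (((i == tgt k) && (j == src k))%:R : C)) : C -> C^o)); last first.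
  apply/funext => w; rewrite summxE fct_sumE.
  by apply: eq_bigr => k _; rewrite !mxE.
apply: derivable_sum => k.
apply: derivableM; last exact: derivable_cst.
exact: (@hom_holomorphic _ _ _ _ _ (cvhs_gamma E k) a 0 0 z Wz).
Qed.

Lemma cvhs_theta_compat a b z : W a z -> W b z ->
  cvhs_theta a z *m transition (dsum L) a b z =
  transition (dsum L) a b z *m cvhs_theta b z.
Proof.
move=> Wa Wb; rewrite mulmx_suml mulmx_sumr; apply: eq_bigr => k _.
rewrite /= /dsum_transition.
have /matrixP/(_ 0 0) := hom_compat (cvhs_gamma E k) Wa Wb.
rewrite !mxE !big_ord1 => e.
apply/matrixP => i j; rewrite mul_mx_diag mul_diag_mx !mxE.
case: eqVneq => [->|_] /=; last by rewrite !mulr0 mul0r.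
case: eqVneq => [->|_] /=; last by rewrite !mulr0 mul0r.
by rewrite !mulr1 e.
Qed.

Definition cvhs_higgs : higgs_bundle n :=
  HiggsBundle (BundleHom cvhs_theta_holomorphic cvhs_theta_compat).

End HiggsOfCVHS.

Section HarmonicMetrics.
Variable n : nat.

(* In a local holomorphic frame, h(u, v) = v^* H u, conjugate-linear in v. *)
Record hermitian_metric (W : open_cover) (V : vector_bundle W n) :=
  HermitianMetric {
  metric_mx : chart_index W -> C -> 'M[C]_n;
  metric_smooth : forall a, mx_smooth_on (W a) (metric_mx a);
  metric_hermitian : forall a z, W a z -> metric_mx a z \is hermsymmx;
  metric_posdef : forall a z, W a z ->
    forall v : 'cV[C]_n, v != 0 -> 0 < (v^t* *m metric_mx a z *m v) 0 0;
  metric_compat : forall a b z, W a z -> W b z ->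
    metric_mx b z =
    (transition V a b z)^t* *m metric_mx a z *m transition V a b z }.

(* A connection d + A' dz + A'' dzbar in a local frame, encoded as (A', A''). *)
Definition connection_form : Type := (C -> 'M[C]_n) * (C -> 'M[C]_n).

(* The coefficient of dz /\ dzbar in the curvature dA + A /\ A. *)
Definition curvature (A : connection_form) (z : C) : 'M[C]_n :=
  mx_dz A.2 z - mx_dzbar A.1 z + (A.1 z *m A.2 z - A.2 z *m A.1 z).

(* In a holomorphic frame the (0,1) part of the Chern connection is dbar, so
   that A'' = 0; compatibility with h then reads d'H = H A'. *)
Definition chern_form (H : C -> 'M[C]_n) : connection_form :=
  (fun z => invmx (H z) *m mx_dz H z, fun=> 0).

(* The adjoint for h: h(T u, v) = h(u, (adjoint H T) v). *)
Definition adjoint (H T : 'M[C]_n) : 'M[C]_n := invmx H *m T^t* *m H.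

(* theta = T dz has adjoint T^* dzbar, and [theta, theta^*] denotes the graded
   commutator theta /\ theta^* + theta^* /\ theta, whose coefficient of
   dz /\ dzbar is T T^* - T^* T. *)
Definition is_harmonic (E : higgs_bundle n) (h : hermitian_metric (higgs_vb E)) :
    Prop :=
  forall a z, higgs_cover E a z ->
    let H := metric_mx h a in
    let T := hom_coef (higgs_field E) a z in
    curvature (chern_form H) z +
      (T *m adjoint (H z) T - adjoint (H z) T *m T) = 0.

Definition admits_harmonic_metric (E : higgs_bundle n) : Prop :=
  exists h : hermitian_metric (higgs_vb E), is_harmonic h.

End HarmonicMetrics.
End Bundles.

(* Main.v *)
Require Import Defs.
From mathcomp Require Import all_boot all_order all_algebra.
From mathcomp Require Import sesquilinear spectral.
From mathcomp Require Import all_classical all_reals all_analysis.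
From mathcomp Require Import complex.
From mathcomp Require Import ring lra.

(** The example is the trivial bundle of rank [n] over the disc with all the maps
[gamma_k] equal to one holomorphic function [g], so that the Higgs field is
[T = g N] with [N] a nilpotent Jordan block.

Suppose that [H] is a harmonic metric, not necessarily diagonal, and let [S] be a
constant matrix commuting with [N]. Since [S] is a holomorphic section of the
endomorphism bundle commuting with the Higgs field, Bochner's formula ([bochner])
combined with the harmonicity equation gives
[d/dzbar d/dz |S|^2 = |nabla S|^2 + |g|^2 |[N^*, S]|^2], where norms and adjoints
are those of [H]. It is used for two choices of [S].

- [S = N]. A nilpotent matrix satisfies [|N|^4 <= kappa |[N^*, N]|^2] with [kappa]
  depending on [n] only ([hnorm_self_commutator]). Hence [log |N|^2] has Laplacian
  at least [4 |g|^2 |N|^2 / kappa], and the Ahlfors-Schwarz lemma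
  ([ahlfors_schwarz]) yields [|N|^2 <= 2 kappa / (M e^2)] at the centre of every
  disc of radius [e] on which [|g|^2 >= M].
- [S = N^(n-1)]. This matrix is nonzero, [|S|^2] is subharmonic, and
  [|S|^2 <= (|N|^2)^(n-1)].

It remains to choose [g] so large, on discs centred at all the points of suitable
circles [|z| = r], that [M e^2] is unbounded as [r] tends to 1. Then [|S|^2] tends
to zero on these circles, and by the maximum principle ([subharmonic_le]) it
vanishes at the origin, a contradiction. The function [g = \sum_k 100^k z^(32^k)]
has this property: at distance about [1/32^k] from the boundary its [k]-th term
dominates the sum of the others, so that [|g| >= 100^k / 4] there ([lacunary_ge]),
and [100^k / 32^k] is unbounded. *)

Set Implicit Arguments.
Unset Strict Implicit.
Unset Printing Implicit Defensive.
Import Order.TTheory GRing.Theory Num.Theory.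
Import numFieldNormedType.Exports.
Local Open Scope classical_set_scope.
Local Open Scope ring_scope.
Local Open Scope complex_scope.
Local Open Scope sesquilinear_scope.

(** * Wirtinger derivatives *)

Section WirtingerCalculus.
Variable R : realType.
Local Notation C := R[i].
Implicit Types (f g : C -> C) (z v a b d : C).

Lemma along0 f v z : along f v z 0 = f z.
Proof. by rewrite /along mul0r addr0. Qed.

Lemma cvg_real_complex (t : R) : real_complex R @ t --> (t%:C : C^o).
Proof.
apply/(@cvgrPdist_lt C C^o) => e e0.
have eE : e = (complex.Re e)%:C.
  by rewrite [LHS]complexE (ger0_Im (ltW e0)) rmorph0 mulr0 addr0.
have r0 : 0 < complex.Re e by rewrite -ltcR -eE.
near=> s; rewrite -rmorphB/= normc_def/= expr0n/= addr0 sqrtr_sqr eE ltcR.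
by near: s; apply: cvgr_dist_lt.
Unshelve. all: by end_near. Qed.

Lemma cvg_along v z :
  (fun t : R => z + t%:C * v : C^o) @ (0 : R) --> (z : C^o).
Proof.
rewrite -[X in _ --> X]addr0 -[X in _ + X](mul0r v).
apply: (@cvgD C C^o); first exact: cvg_cst.
apply: (@cvgM C); last exact: cvg_cst.
exact: cvg_real_complex.
Qed.

(** A relational form of [rderive]: derivatives are computed by chaining the rules
below, and differentiability comes with them. *)
Definition has_rder v f z d : Prop :=
  is_derive (0 : R) (1 : R) (fun t : R => complex.Re (along f v z t))
    (complex.Re d) /\
  is_derive (0 : R) (1 : R) (fun t : R => complex.Im (along f v z t))
    (complex.Im d).

Lemma rderivable_has_rder v f z :
  rderivable v f z -> has_rder v f z (rderive v f z).
Proof.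
by case=> d1 d2; split; rewrite /= derive1E; apply/derivableP.
Qed.

Lemma has_rder_rderive v f z d : has_rder v f z d -> rderive v f z = d.
Proof.
by case=> [[_ d1] [_ d2]]; rewrite /rderive !derive1E d1 d2; case: (d).
Qed.

Lemma has_rder_cst v z a : has_rder v (fun=> a) z 0.
Proof. by split; exact: is_derive_cst. Qed.

Lemma has_rderD v f g z a b : has_rder v f z a -> has_rder v g z b ->
  has_rder v (fun w => f w + g w) z (a + b).
Proof.
case=> f1 f2 [g1 g2]; split.
- rewrite raddfD/=; have := is_deriveD f1 g1; congr (is_derive _ _ _ _).
  by apply/funext => t; rewrite /along/= raddfD.
- rewrite raddfD/=; have := is_deriveD f2 g2; congr (is_derive _ _ _ _).
  by apply/funext => t; rewrite /along/= raddfD.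
Qed.

Lemma Re_addc (x y : C) : complex.Re (x + y) = complex.Re x + complex.Re y.
Proof. by case: x y => [? ?] [? ?]. Qed.

Lemma Im_addc (x y : C) : complex.Im (x + y) = complex.Im x + complex.Im y.
Proof. by case: x y => [? ?] [? ?]. Qed.

Lemma Re_mulc (x y : C) :
  complex.Re (x * y) = complex.Re x * complex.Re y - complex.Im x * complex.Im y.
Proof. by case: x y => [? ?] [? ?]. Qed.

Lemma Im_mulc (x y : C) :
  complex.Im (x * y) = complex.Re x * complex.Im y + complex.Im x * complex.Re y.
Proof. by case: x y => [? ?] [? ?]. Qed.

Lemma has_rderM v f g z a b : has_rder v f z a -> has_rder v g z b ->
  has_rder v (fun w => f w * g w) z (a * g z + f z * b).
Proof.
case=> f1 f2 [g1 g2]; split.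
- have := is_deriveB (is_deriveM f1 g1) (is_deriveM f2 g2).
  congr (is_derive _ _ _ _); first by apply/funext => t; rewrite !fctE -Re_mulc.
  by rewrite /= Re_addc !Re_mulc/= !along0 /GRing.scale/=; ring.
- have := is_deriveD (is_deriveM f1 g2) (is_deriveM f2 g1).
  congr (is_derive _ _ _ _); first by apply/funext => t; rewrite !fctE -Im_mulc.
  by rewrite /= Im_addc !Im_mulc/= !along0 /GRing.scale/=; ring.
Qed.

Lemma has_rderV v f z a : f z != 0 -> has_rder v f z a ->
  has_rder v (fun w => (f w)^-1) z (- a / f z ^+ 2).
Proof.
move=> fz0 [f1 f2].
have sE (x : C) : x != 0 -> complex.Re x ^+ 2 + complex.Im x ^+ 2 != 0.
  by rewrite -(inj_eq (@complexI R)) add_Re2_Im2 rmorph0 expf_eq0/= normr_eq0.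
have s1 := is_deriveD (is_deriveX 2 f1) (is_deriveX 2 f2).
have s0 : (((fun t : R => complex.Re (along f v z t)) ^+ 2 +
  (fun t : R => complex.Im (along f v z t)) ^+ 2) : R -> R) 0 != 0.
  by rewrite /= !fctE !along0; exact: sE.
have sV := is_deriveV s0 s1.
pose s := complex.Re (f z) ^+ 2 + complex.Im (f z) ^+ 2.
have aE : - a / f z ^+ 2 =
    - a * ((complex.Re (f z) -i* complex.Im (f z)) ^+ 2 * (s ^- 2)%:C).
  congr (_ * _).
  have -> : (s ^- 2)%:C = (f z)^- 2 * (f z)^*%C ^- 2.
    rewrite fmorphV rmorphXn/= add_Re2_Im2 sqr_normc exprMn invfM //.
  have -> : (complex.Re (f z) -i* complex.Im (f z)) = (f z)^*%C by case: (f z).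
  rewrite mulrCA mulfV ?mulr1//.
  by rewrite expf_neq0// fmorph_eq0.
split.
- have := is_deriveM f1 sV.
  congr (is_derive _ _ _ _).
    apply/funext => t; rewrite /along !fctE.
    by case: (f _).
  rewrite aE /s/= !fctE !along0 /GRing.scale/=.
  move: (sE _ fz0); case: (f z) => p q /= s0'; case: (a) => c d /=.
  by field.
- have := is_deriveM (is_deriveN f2) sV.
  congr (is_derive _ _ _ _).
    apply/funext => t; rewrite /along !fctE.
    by case: (f _) => p q/=; rewrite mulNr.
  rewrite aE /s/= !fctE !along0 /GRing.scale/=.
  move: (sE _ fz0); case: (f z) => p q /= s0'; case: (a) => c d /=.
  by field.
Qed.

Lemma has_rder_conj v f z a : has_rder v f z a ->
  has_rder v (fun w => (f w)^*%C) z (a^*%C).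
Proof.
case=> f1 f2; split.
- move: f1; congr (is_derive _ _ _ _); last by case: (a).
  by apply/funext => t; rewrite /along; case: (f _).
- have := is_deriveN f2; congr (is_derive _ _ _ _); last by case: (a).
  by apply/funext => t; rewrite /along !fctE; case: (f _).
Qed.

Lemma has_rder_near v f g z a : (\forall w \near (z : C^o), f w = g w) ->
  has_rder v f z a -> has_rder v g z a.
Proof.
move=> fg [f1 f2].
have near0 : \forall t \near (0 : R), along f v z t = along g v z t.
  exact: (@cvg_along v z _ fg).
by split; [apply: near_eq_is_derive f1|apply: near_eq_is_derive f2];
  move: near0; apply: filterS => t ->.
Qed.

(** That is, [df = a dz + b dzbar] at [z], evaluated on the directions [1] and
['i%C]. *)
Definition has_wirt f z a b : Prop :=
  has_rder 1 f z (a + b) /\ has_rder 'i%C f z ('i%C * (a - b)).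

Lemma has_wirt_derive f z a b : has_wirt f z a b ->
  dz f z = a /\ dzbar f z = b.
Proof.
case=> /has_rder_rderive d1 /has_rder_rderive d2.
have ii : 'i%C * 'i%C = -1 :> C by rewrite -expr2 sqr_i.
split.
- by rewrite /dz d1 d2 mulrA ii; field.
- by rewrite /dzbar d1 d2 mulrA ii; field.
Qed.

Lemma rderivable_has_wirt f z : rderivable 1 f z -> rderivable 'i%C f z ->
  has_wirt f z (dz f z) (dzbar f z).
Proof.
move=> /rderivable_has_rder d1 /rderivable_has_rder d2.
have ii : 'i%C * 'i%C = -1 :> C by rewrite -expr2 sqr_i.
rewrite /has_wirt; split.
- by rewrite (_ : _ + _ = rderive 1 f z)//; rewrite /dz /dzbar; field.
- rewrite (_ : _ * _ = rderive 'i%C f z)//.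
  transitivity (- ('i%C * 'i%C) * rderive 'i%C f z); last by rewrite ii opprK mul1r.
  by rewrite /dz /dzbar; field.
Qed.

Lemma has_wirt_cst z a : has_wirt (fun=> a) z 0 0.
Proof. by split; rewrite ?subrr ?mulr0 ?addr0; exact: has_rder_cst. Qed.

Lemma has_wirtD f g z a b c d : has_wirt f z a b -> has_wirt g z c d ->
  has_wirt (fun w => f w + g w) z (a + c) (b + d).
Proof.
case=> f1 f2 [g1 g2]; split.
- by rewrite addrACA; exact: has_rderD.
- by rewrite opprD addrACA mulrDr; exact: has_rderD.
Qed.

Lemma has_wirtM f g z a b c d : has_wirt f z a b -> has_wirt g z c d ->
  has_wirt (fun w => f w * g w) z (a * g z + f z * c) (b * g z + f z * d).
Proof.
case=> f1 f2 [g1 g2]; split.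
- have := has_rderM f1 g1; congr has_rder; ring.
- have := has_rderM f2 g2; congr has_rder; ring.
Qed.

Lemma has_wirtV f z a b : f z != 0 -> has_wirt f z a b ->
  has_wirt (fun w => (f w)^-1) z (- a / f z ^+ 2) (- b / f z ^+ 2).
Proof.
move=> fz [f1 f2]; split.
- have := has_rderV fz f1; congr has_rder; ring.
- have := has_rderV fz f2; congr has_rder; ring.
Qed.

Lemma has_wirt_conj f z a b : has_wirt f z a b ->
  has_wirt (fun w => (f w)^*%C) z (b^*%C) (a^*%C).
Proof.
have iJ : ('i%C)^*%C = - 'i%C :> C by apply/eqP; rewrite eq_complex/= oppr0 !eqxx.
case=> f1 f2; split.
- have := has_rder_conj f1; congr has_rder; rewrite rmorphD/=; ring.
- have := has_rder_conj f2; congr has_rder.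
  by rewrite [LHS]rmorphM rmorphB [X in X * _]iJ; ring.
Qed.

Lemma has_wirt_near f g z a b : (\forall w \near (z : C^o), f w = g w) ->
  has_wirt f z a b -> has_wirt g z a b.
Proof. by move=> fg [? ?]; split; exact: has_rder_near fg _. Qed.

Lemma has_wirt_sum (I : Type) (r : seq I) (P : pred I) (F : I -> C -> C)
    (a b : I -> C) z : (forall i, P i -> has_wirt (F i) z (a i) (b i)) ->
  has_wirt (fun w => \sum_(i <- r | P i) F i w) z
    (\sum_(i <- r | P i) a i) (\sum_(i <- r | P i) b i).
Proof.
move=> h; elim: r => [|i r IH].
  rewrite !big_nil.
  have := has_wirt_cst z 0; congr (has_wirt _ _ _ _).
  by apply/funext => w; rewrite big_nil.
rewrite !big_cons; case: ifPn => Pi.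
  have := has_wirtD (h _ Pi) IH; congr (has_wirt _ _ _ _).
  by apply/funext => w; rewrite big_cons Pi.
move: IH; congr (has_wirt _ _ _ _).
by apply/funext => w; rewrite big_cons (negbTE Pi).
Qed.

End WirtingerCalculus.

(** * Matrix-valued functions of class C1 *)

Section C1.
Variable R : realType.
Local Notation C := R[i].
Implicit Types (f g : C -> C) (z : C).

(** Continuity is a separate requirement, since it does not follow from the
existence of partial derivatives along the two axes. *)
Definition c1 f z : Prop :=
  {for z, continuous (f : C^o -> C^o)} /\ exists a b, has_wirt f z a b.

Lemma c1_cst a z : c1 (fun=> a) z.
Proof.
split; first exact: (@cst_continuous C^o C^o).
by exists 0, 0; exact: has_wirt_cst.
Qed.

Lemma c1D f g z : c1 f z -> c1 g z -> c1 (fun w => f w + g w) z.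
Proof.
move=> [f0 [a [b f1]]] [g0 [c [d g1]]]; split.
  exact: (@continuousD C C^o C^o (f : C^o -> C^o) (g : C^o -> C^o) z f0 g0).
by eexists; eexists; exact: (has_wirtD f1 g1).
Qed.

Lemma c1M f g z : c1 f z -> c1 g z -> c1 (fun w => f w * g w) z.
Proof.
move=> [f0 [a [b f1]]] [g0 [c [d g1]]]; split.
  exact: (@continuousM C C^o (f : C^o -> C^o) (g : C^o -> C^o) z f0 g0).
by eexists; eexists; exact: (has_wirtM f1 g1).
Qed.

Lemma c1V f z : f z != 0 -> c1 f z -> c1 (fun w => (f w)^-1) z.
Proof.
move=> fz [f0 [a [b f1]]]; split.
  exact: (@continuousV C C^o (f : C^o -> C^o) z fz f0).
by eexists; eexists; exact: (has_wirtV fz f1).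
Qed.

Lemma continuous_conjc : continuous (fun z : C^o => z^*%C : C^o).
Proof.
move=> z; apply/(@cvgrPdist_lt C C^o _ (nbhs (z : C^o)) (nbhs_filter _)) => e e0.
near=> w.
rewrite -rmorphB normcJ; near: w.
exact: (@cvgr_dist_lt C C^o _ _ _ id z).
Unshelve. all: by end_near. Qed.

Lemma c1_conj f z : c1 f z -> c1 (fun w => (f w)^*%C) z.
Proof.
move=> [f0 [a [b f1]]]; split.
  exact: (@cvg_comp _ _ _ (f : C^o -> C^o) (fun w : C^o => w^*%C : C^o) _ _ _
    f0 (@continuous_conjc (f z))).
by eexists; eexists; exact: (has_wirt_conj f1).
Qed.

Lemma c1_near f g z : (\forall w \near (z : C^o), f w = g w) -> c1 f z -> c1 g z.
Proof.
move=> fg [f0 [a [b f1]]]; split.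
  rewrite /prop_for /continuous_at -(nbhs_singleton fg).
  apply: cvg_trans f0.
  by apply: near_eq_cvg; [exact: (@nbhs_filter C^o)|exact: fg].
by exists a, b; exact: (has_wirt_near fg f1).
Qed.

Lemma c1_sum (I : Type) (r : seq I) (P : pred I) (F : I -> C -> C) z :
  (forall i, P i -> c1 (F i) z) -> c1 (fun w => \sum_(i <- r | P i) F i w) z.
Proof.
move=> h; elim: r => [|i r IH].
  by under eq_fun do rewrite big_nil; exact: c1_cst.
under eq_fun do rewrite big_cons.
by case Pi : (P i) => //; exact: (c1D (h _ Pi) IH).
Qed.

Lemma c1_prod (I : Type) (r : seq I) (P : pred I) (F : I -> C -> C) z :
  (forall i, P i -> c1 (F i) z) -> c1 (fun w => \prod_(i <- r | P i) F i w) z.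
Proof.
move=> h; elim: r => [|i r IH].
  by under eq_fun do rewrite big_nil; exact: c1_cst.
under eq_fun do rewrite big_cons.
by case Pi : (P i) => //; exact: (c1M (h _ Pi) IH).
Qed.

Definition mxc1 m n (A : C -> 'M[C]_(m, n)) z : Prop :=
  forall i j, c1 (fun w => A w i j) z.

Lemma mxc1_cst m n (A : 'M[C]_(m, n)) z : mxc1 (fun=> A) z.
Proof. by move=> i j; exact: c1_cst. Qed.

Lemma mxc1M m n p (A : C -> 'M[C]_(m, n)) (B : C -> 'M[C]_(n, p)) z :
  mxc1 A z -> mxc1 B z -> mxc1 (fun w => A w *m B w) z.
Proof.
move=> a1 b1 i j; under eq_fun do rewrite mxE.
by apply: c1_sum => k _; exact: c1M.
Qed.

Lemma c1_mxtrace n (A : C -> 'M[C]_n) z :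
  mxc1 A z -> c1 (fun w => \tr (A w)) z.
Proof. by move=> a1; apply: c1_sum. Qed.

Lemma c1_det n (A : C -> 'M[C]_n) z : mxc1 A z -> c1 (fun w => \det (A w)) z.
Proof.
move=> a1; apply: c1_sum => s _; apply: c1M; first exact: c1_cst.
by apply: c1_prod.
Qed.

Lemma mxc1V n (A : C -> 'M[C]_n) z :
  (\forall w \near (z : C^o), A w \in unitmx) -> mxc1 A z ->
  mxc1 (fun w => invmx (A w)) z.
Proof.
move=> Au a1 i j.
apply: (@c1_near (fun w => (\det (A w))^-1 *
    ((-1) ^+ (j + i) * \det (row' j (col' i (A w)))))).
  by move: Au; apply: filterS => w Aw; rewrite /invmx Aw !mxE.
apply: c1M.
  apply: c1V; last exact: c1_det.
  by rewrite -unitfE; exact: (nbhs_singleton Au).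
apply: c1M; first exact: c1_cst.
by apply: c1_det => k l; under eq_fun do rewrite !mxE; exact: a1.
Qed.

Definition has_mxwirt m n (A : C -> 'M[C]_(m, n)) z (A' A'' : 'M[C]_(m, n)) :=
  forall i j, has_wirt (fun w => A w i j) z (A' i j) (A'' i j).

Lemma has_mxwirt_derive m n (A : C -> 'M[C]_(m, n)) z A' A'' :
  has_mxwirt A z A' A'' -> mx_dz A z = A' /\ mx_dzbar A z = A''.
Proof.
by move=> a; split; apply/matrixP => i j; rewrite mxE;
  have [? ?] := has_wirt_derive (a i j).
Qed.

Lemma mxc1_has_mxwirt m n (A : C -> 'M[C]_(m, n)) z :
  mxc1 A z -> has_mxwirt A z (mx_dz A z) (mx_dzbar A z).
Proof.
move=> a1 i j; rewrite !mxE; have [_ [a [b ab]]] := a1 i j.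
by have [-> ->] := has_wirt_derive ab.
Qed.

Lemma has_mxwirt_cst m n (A : 'M[C]_(m, n)) z : has_mxwirt (fun=> A) z 0 0.
Proof. by move=> i j; rewrite !mxE; exact: has_wirt_cst. Qed.

Lemma has_mxwirtM m n p (A : C -> 'M[C]_(m, n)) (B : C -> 'M[C]_(n, p)) z
    A' A'' B' B'' : has_mxwirt A z A' A'' -> has_mxwirt B z B' B'' ->
  has_mxwirt (fun w => A w *m B w) z (A' *m B z + A z *m B')
    (A'' *m B z + A z *m B'').
Proof.
move=> a b i j; under eq_fun do rewrite mxE.
rewrite !mxE -!big_split/=.
by apply: has_wirt_sum => k _; exact: has_wirtM.
Qed.

Lemma has_mxwirtD m n (A B : C -> 'M[C]_(m, n)) z A' A'' B' B'' :
  has_mxwirt A z A' A'' -> has_mxwirt B z B' B'' ->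
  has_mxwirt (fun w => A w + B w) z (A' + B') (A'' + B'').
Proof.
move=> a b i j; under eq_fun do rewrite mxE.
by rewrite !mxE; exact: has_wirtD.
Qed.

Lemma has_mxwirtN m n (A : C -> 'M[C]_(m, n)) z A' A'' :
  has_mxwirt A z A' A'' -> has_mxwirt (fun w => - A w) z (- A') (- A'').
Proof.
move=> a i j; under eq_fun do rewrite mxE -mulN1r.
rewrite !mxE; have := has_wirtM (has_wirt_cst z (-1)) (a i j).
by rewrite !mul0r !add0r !mulN1r.
Qed.

Lemma has_mxwirt_conj m n (A : C -> 'M[C]_(m, n)) z A' A'' :
  has_mxwirt A z A' A'' -> has_mxwirt (fun w => (A w)^t*) z (A''^t*) (A'^t*).
Proof.
move=> a i j; under eq_fun do rewrite !mxE.
by rewrite !mxE; exact: has_wirt_conj.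
Qed.

Lemma has_wirt_mxtrace n (A : C -> 'M[C]_n) z A' A'' :
  has_mxwirt A z A' A'' ->
  has_wirt (fun w => \tr (A w)) z (\tr A') (\tr A'').
Proof. by move=> a; apply: has_wirt_sum. Qed.

Lemma has_mxwirt_near m n (A B : C -> 'M[C]_(m, n)) z A' A'' :
  (\forall w \near (z : C^o), A w = B w) ->
  has_mxwirt A z A' A'' -> has_mxwirt B z A' A''.
Proof.
move=> AB a i j; apply: has_wirt_near (a i j).
by move: AB; apply: filterS => w ->.
Qed.

(** [d(A^-1) = - A^-1 dA A^-1], read off from [A A^-1 = 1]. *)
Lemma has_mxwirtV n (A : C -> 'M[C]_n) z A' A'' :
  (\forall w \near (z : C^o), A w \in unitmx) -> mxc1 A z ->
  has_mxwirt A z A' A'' ->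
  has_mxwirt (fun w => invmx (A w)) z (- (invmx (A z) *m A' *m invmx (A z)))
    (- (invmx (A z) *m A'' *m invmx (A z))).
Proof.
move=> Au a1 a; have Az := nbhs_singleton Au.
have k := mxc1_has_mxwirt (mxc1V Au a1).
have [p1 p2] := has_mxwirt_derive (has_mxwirtM a k).
have : has_mxwirt (fun w => A w *m invmx (A w)) z 0 0.
  apply: has_mxwirt_near (has_mxwirt_cst 1%:M z).
  by move: Au; apply: filterS => w Aw; rewrite mulmxV.
move=> /has_mxwirt_derive[]; rewrite {}p1 {}p2 => e1 e2.
have solve (B X : 'M[C]_n) : B *m invmx (A z) + A z *m X = 0 ->
    X = - (invmx (A z) *m B *m invmx (A z)).
  move=> /(congr1 (mulmx (invmx (A z)))).
  rewrite mulmxDr mulKmx// mulmx0 mulmxA => /eqP.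
  by rewrite addrC addr_eq0 => /eqP.
by rewrite -(solve _ _ e1) -(solve _ _ e2).
Qed.

End C1.

(** * Maximum tests *)

Section MaximumTests.
Variable R : realType.
Local Notation C := R[i].
Implicit Types (f g : C -> C) (z v a b d : C).

(** If the second derivative were positive at the maximum, the first derivative
would be positive just to the right of it, and the mean value theorem would give
larger values there. *)
Lemma second_derivative_test (phi : R -> R) (e : R) (l : R) : 0 < e ->
  (forall t : R, `|t| < e -> derivable phi t 1) ->
  is_derive (0 : R) (1 : R) (derive1 phi) l ->
  (forall t, `|t| < e -> phi t <= phi 0) ->
  (derive1 phi) 0 = 0 /\ l <= 0.
Proof.
move=> e0 dphi [dd lE] mx.
have in_e (t : R) : t \in `](- e), e[ -> `|t| < e.
  by rewrite in_itv/= ltr_norml.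
have d0 : (derive1 phi) 0 = 0.
  have [] := @derive1_at_max R phi (- e) e 0.
  - by rewrite lerNl; lra.
  - by move=> t /in_e/dphi.
  - by rewrite in_itv/=; lra.
  - by move=> t /in_e/mx.
  - by move=> _ h; rewrite derive1E.
split => //; rewrite leNgt; apply/negP => l0.
have : (fun h : R => h^-1 * (derive1 phi) h) @ 0^' --> l.
  have E : (fun h : R => h^-1 *: (((derive1 phi) \o shift 0) (h *: (1 : R)) -
      (derive1 phi) 0)) = (fun h : R => h^-1 * (derive1 phi) h).
    by apply/funext => h; rewrite /= d0 subr0 addr0 /GRing.scale/= mulr1.
  by move: dd; rewrite -lE /derive /derivable E.
move=> /cvgr_gt/(_ _ l0) [r /= r0 rP].
pose s := Num.min r e / 2.
have s0 : 0 < s by rewrite divr_gt0// lt_min r0 e0.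
have sr : s < r.
  have : Num.min r e <= r by rewrite ge_min lexx.
  by rewrite /s => ?; lra.
have se : s < e.
  have : Num.min r e <= e by rewrite ge_min lexx orbT.
  by rewrite /s => ?; lra.
have [||c] := @MVT R phi (derive1 phi) 0 s s0.
- move=> x; rewrite in_itv/= => /andP[x0 xs]; rewrite derive1E.
  by apply/derivableP/dphi; rewrite gtr0_norm// (lt_trans xs).
- apply: derivable_within_continuous => x; rewrite in_itv/= => /andP[x0 xs].
  by apply: dphi; rewrite ger0_norm// (le_lt_trans xs).
rewrite in_itv/= subr0 => /andP[c0 cs] h.
have : 0 < c^-1 * (derive1 phi) c.
  apply: rP => /=; last by rewrite gt_eqF.
  by rewrite sub0r normrN gtr0_norm// (lt_trans cs).
rewrite pmulr_rgt0 ?invr_gt0// => pc.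
have := mx s; rewrite gtr0_norm// => /(_ se).
rewrite -subr_le0 h leNgt => /negP; apply; exact: mulr_gt0.
Qed.

Lemma is_derive_along f v z t d : has_rder v f (z + t%:C * v) d ->
  is_derive t (1 : R) (fun s : R => complex.Re (along f v z s)) (complex.Re d).
Proof.
case=> [[h1 h2] _].
have sh : (fun s : R => complex.Re (along f v (z + t%:C * v) s)) =
   (fun s : R => complex.Re (along f v z s)) \o shift t.
  by apply/funext => s /=; rewrite /along rmorphD mulrDl -addrA [X in z + X]addrC.
pose F := fun s : R => complex.Re (along f v z s).
have E : (fun h : R => h^-1 *: (((F \o shift t) \o shift (0 : R)) (h *: (1 : R)) -
    (F \o shift t) 0)) =
  (fun h : R => h^-1 *: ((F \o shift t) (h *: (1 : R)) - F t)).
  by apply/funext => h; rewrite /= add0r addr0.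
rewrite sh in h1 h2.
by split; [move: h1|rewrite -h2]; rewrite /derivable /derive -/F E.
Qed.

(** At an interior maximum the gradient vanishes and the Laplacian, which is
four times [d/dzbar d/dz], is nonpositive.  The conjugate pair [D], [(D w)^*]
expresses that the differential of [f] is real. *)
Lemma wirt_max_test (U : set C) f (D : C -> C) z a b :
  open (U : set C^o) -> U z ->
  (forall w, U w -> has_wirt f w (D w) (D w)^*%C) ->
  has_wirt D z a b ->
  (forall w, U w -> complex.Re (f w) <= complex.Re (f z)) ->
  D z = 0 /\ complex.Re b <= 0.
Proof.
move=> Uo Uz fD [D1 D2] mx.
have Un : nbhs (z : C^o) U by exact: open_nbhs_nbhs.
have nearU v : exists2 e : R, 0 < e &
    forall t, `|t| < e -> U (z + t%:C * v).
  have [e /= e0 eP] := @cvg_along R v z _ Un.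
  exists e => // t te; apply: eP.
  by rewrite /= sub0r normrN.
have test v (c : C -> R) (l : R) :
    (forall w, U w -> exists d, has_rder v f w d /\ complex.Re d = c w) ->
    is_derive (0 : R) (1 : R) (fun t : R => c (z + t%:C * v)) l ->
    c z = 0 /\ l <= 0.
  move=> fc dl; have [e e0 eP] := nearU v.
  pose phi (t : R) := complex.Re (along f v z t).
  have dphi t : `|t| < e -> is_derive t (1 : R) phi (c (z + t%:C * v)).
    by move=> /eP/fc[d [/is_derive_along h <-]].
  have [] := @second_derivative_test phi e l e0.
  - by move=> t /dphi[].
  - apply: near_eq_is_derive dl; exists e => //= t.
    rewrite /ball_/= sub0r normrN => /dphi[_ h].
    by rewrite derive1E h.
  - by move=> t /eP/mx; rewrite {2}/phi along0.
  have := dphi 0; rewrite normr0 => /(_ e0) [_ h].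
  by rewrite derive1E h mul0r addr0.
have [r1 l1] : 2 * complex.Re (D z) = 0 /\ 2 * complex.Re (a + b) <= 0.
  apply: (test 1 (fun w => 2 * complex.Re (D w))).
    move=> w /fD[h _]; eexists; split; first exact: h.
    by rewrite Re_addc; case: (D w) => x y /=; ring.
  exact: (is_deriveZ _ (proj1 D1)).
have [r2 l2] : - 2 * complex.Im (D z) = 0 /\ - 2 * complex.Im ('i%C * (a - b)) <= 0.
  apply: (test 'i%C (fun w => - 2 * complex.Im (D w))).
    move=> w /fD[_ h]; eexists; split; first exact: h.
    by rewrite Re_mulc; case: (D w) => x y /=; ring.
  exact: (is_deriveZ _ (proj2 D2)).
split.
  apply/eqP; rewrite eq_complex /=; apply/andP; split; apply/eqP; lra.
move: l1 l2; rewrite Im_mulc !Re_addc; case: (a) (b) => [? ?] [? ?] /= ? ?; lra.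
Qed.

Lemma ltc_normE z (r : R) : 0 <= r ->
  (`|z| <= r%:C) = (complex.Re z ^+ 2 + complex.Im z ^+ 2 <= r ^+ 2).
Proof.
move=> r0; rewrite normc_def lecR.
by rewrite -[in LHS](ger0_norm r0) -sqrtr_sqr ler_sqrt// sqr_ge0.
Qed.

(** The real coordinates of [w - p] transfer the compactness of closed bounded
subsets of [R * R] to the disc. *)
Lemma disc_max (phi : C -> R) (p : C) (r : R) : 0 <= r ->
  (forall w, `|w - p| <= r%:C -> {for w, continuous (phi : C^o -> R)}) ->
  exists2 c, `|c - p| <= r%:C & forall w, `|w - p| <= r%:C -> phi w <= phi c.
Proof.
move=> r0 phic.
pose g (xy : R * R) : C^o := p + (xy.1%:C + 'i%C * xy.2%:C).
have gE xy : complex.Re (g xy - p) = xy.1 /\ complex.Im (g xy - p) = xy.2.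
  by rewrite /g addrAC subrr add0r; case: xy => x y /=; split; ring.
have gc : continuous g.
  move=> xy; apply: (@cvgD C C^o); first exact: cvg_cst.
  apply: (@cvgD C C^o).
    apply: (@cvg_comp _ _ _ fst (real_complex R : R -> C^o)); first exact: cvg_fst.
    exact: cvg_real_complex.
  apply: (@cvgM C); first exact: cvg_cst.
  apply: (@cvg_comp _ _ _ snd (real_complex R : R -> C^o)); first exact: cvg_snd.
  exact: cvg_real_complex.
pose K := [set xy : R * R | xy.1 ^+ 2 + xy.2 ^+ 2 <= r ^+ 2].
have KE xy : K xy <-> `|g xy - p| <= r%:C.
  by rewrite ltc_normE//; have [-> ->] := gE xy.
have Kclosed : closed K.
  apply: (@closed_comp _ _ (fun xy : R * R => xy.1 ^+ 2 + xy.2 ^+ 2)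
    [set x | x <= r ^+ 2]); last exact: closed_le.
  by move=> xy _; apply: (@cvgD R R^o); apply: (@cvgM R);
    [exact: cvg_fst|exact: cvg_fst|exact: cvg_snd|exact: cvg_snd].
have Kcompact : compact K.
  apply: (@subclosed_compact _ K (`[- r, r] `*` `[- r, r])) => //.
    by apply: compact_setX; exact: segment_compact.
  move=> [x y]; rewrite /K/= => h.
  rewrite !in_itv/= -!ler_norml -(ler_pXn2r (n:=2))//= ?nnegrE//.
  rewrite -[`|y| <= r](ler_pXn2r (n:=2))//= ?nnegrE// !real_normK ?num_real//.
  have := sqr_ge0 x; have := sqr_ge0 y => ? ?; split; lra.
have K0 : K !=set0 by exists (0, 0); rewrite /K/= expr0n/= addr0 sqr_ge0.
have psic : {within K, continuous (phi \o g)}.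
  apply: continuous_in_subspaceT => xy; rewrite inE => /KE h.
  apply: continuous_comp; first exact: gc.
  exact: phic.
have [c cK cmax] := compact_EVT_max K0 Kcompact psic.
exists (g c); first by apply/KE; rewrite -inE.
move=> w wp.
have wE : w = g (complex.Re (w - p), complex.Im (w - p)).
  by rewrite /g /= -complexE addrC subrK.
rewrite wE; apply: cmax; rewrite inE; apply/KE; rewrite -wE//.
Qed.

End MaximumTests.

(** * The Frobenius norm and the self-commutator of a nilpotent matrix *)

Section Frobenius.
Variable C : numClosedFieldType.
Implicit Types m n p : nat.

Lemma trmxC_mul m n p (A : 'M[C]_(m, n)) (B : 'M[C]_(n, p)) :
  (A *m B)^t* = B^t* *m A^t*.
Proof. by rewrite trmx_mul map_mxM. Qed.

Lemma trmxCD m n (A B : 'M[C]_(m, n)) : (A + B)^t* = A^t* + B^t*.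
Proof. by rewrite linearD map_mxD. Qed.

Lemma trmxCN m n (A : 'M[C]_(m, n)) : (- A)^t* = - A^t*.
Proof. by rewrite linearN map_mxN. Qed.

Lemma trmxCZ m n a (A : 'M[C]_(m, n)) : (a *: A)^t* = a^*%R *: A^t*.
Proof. by rewrite linearZ map_mxZ. Qed.

Lemma mxtrace_trmxC n (A : 'M[C]_n) : \tr (A^t*) = (\tr A)^*%R.
Proof. by rewrite rmorph_sum; apply: eq_bigr => i _; rewrite !mxE. Qed.

Lemma invmx_trmxC n (A : 'M[C]_n) : invmx (A^t*) = (invmx A)^t*.
Proof. by rewrite -map_invmx -trmx_inv. Qed.

Lemma mxtraceB n (A B : 'M[C]_n) : \tr (A - B) = \tr A - \tr B.
Proof. exact: raddfB. Qed.

(** The square of the Frobenius (Hilbert-Schmidt) norm. *)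
Definition frob m n (A : 'M[C]_(m, n)) : C := \tr (A *m A^t*).

Lemma frobE m n (A : 'M[C]_(m, n)) : frob A = \sum_i \sum_j `|A i j| ^+ 2.
Proof.
apply: eq_bigr => i _; rewrite mxE; apply: eq_bigr => j _.
by rewrite !mxE -normCK.
Qed.

Lemma frob_ge0 m n (A : 'M[C]_(m, n)) : 0 <= frob A.
Proof.
by rewrite frobE; apply: sumr_ge0 => i _; apply: sumr_ge0 => j _; rewrite exprn_ge0.
Qed.

Lemma frob_eq0 m n (A : 'M[C]_(m, n)) : frob A = 0 -> A = 0.
Proof.
rewrite frobE => /eqP; rewrite psumr_eq0 => [/allP h|i _]; last first.
  by apply: sumr_ge0 => j _; rewrite exprn_ge0.
apply/matrixP => i j; have := h i (mem_index_enum _); rewrite /= psumr_eq0.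
  by move=> /allP/(_ j (mem_index_enum _))/=; rewrite expf_eq0/= normr_eq0 mxE => /eqP.
by move=> k _; rewrite exprn_ge0.
Qed.

Lemma frob_real m n (A : 'M[C]_(m, n)) : (frob A)^*%R = frob A.
Proof. exact/CrealP/ger0_real/frob_ge0. Qed.

Lemma frob_trmxC m n (A : 'M[C]_(m, n)) : frob (A^t*) = frob A.
Proof. by rewrite /frob trmxCK mxtrace_mulC. Qed.

Lemma frobN m n (A : 'M[C]_(m, n)) : frob (- A) = frob A.
Proof. by rewrite /frob trmxCN mulNmx mulmxN opprK. Qed.

(* Expand the square norm of [b A - c B] with [b = |B|^2], [c = <A, B>]. *)
Lemma frob_CauchySchwarz m n (A B : 'M[C]_(m, n)) :
  `|\tr (A *m B^t*)| ^+ 2 <= frob A * frob B.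
Proof.
have [b0|b0] := eqVneq (frob B) 0.
  rewrite (frob_eq0 b0) trmx0 map_mx0 mulmx0 mxtrace0 normr0 expr0n/=.
  by rewrite mulr_ge0// frob_ge0.
set c := \tr _.
have cE : \tr (B *m A^t*) = c^*%R by rewrite -mxtrace_trmxC trmxC_mul trmxCK.
have := frob_ge0 (frob B *: A - c *: B).
have -> : frob (frob B *: A - c *: B) = frob B * (frob A * frob B - `|c| ^+ 2).
  rewrite {1}/frob trmxCD trmxCN !trmxCZ frob_real mulmxBl !mulmxBr.
  rewrite -!scalemxAl -!scalemxAr !mxtraceB !mxtraceZ.
  rewrite cE -/c -/(frob A) -/(frob B) normCK; ring.
by rewrite pmulr_rge0 ?subr_ge0// lt_neqAle eq_sym b0 frob_ge0.
Qed.

Lemma frob_mulmx m n p (A : 'M[C]_(m, n)) (B : 'M[C]_(n, p)) :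
  frob (A *m B) <= frob A * frob B.
Proof.
have -> : frob A * frob B = \sum_i \sum_j frob (row i A) * frob (col j B).
  rewrite -[frob B]frob_trmxC !frobE mulr_suml; apply: eq_bigr => i _.
  rewrite mulr_sumr; apply: eq_bigr => j _.
  rewrite -[frob (col j B)]frob_trmxC !frobE !big_ord1.
  congr (_ * _); apply: eq_bigr => k _; rewrite !mxE//.
rewrite frobE; apply: ler_sum => i _; apply: ler_sum => j _.
rewrite -[frob (col j B)]frob_trmxC.
apply: le_trans (frob_CauchySchwarz _ _).
rewrite trmxCK /mxtrace big_ord1 !mxE.
by under [in leRHS]eq_bigr do rewrite !mxE.
Qed.

Lemma frob_unitary n (P A : 'M[C]_n) : P \is unitarymx ->
  frob (P *m A *m P^t*) = frob A.
Proof.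
move=> Pu; rewrite /frob !trmxC_mul trmxCK !mulmxA mxtrace_mulC !mulmxA.
have PP : P^t* *m P = 1%:M.
  by rewrite -invmx_unitary// mulVmx// unitarymx_unit.
by rewrite PP mul1mx -(mulmxA A) PP mulmx1.
Qed.

(** A nilpotent matrix is far from normal: its self-commutator controls it.  In
a unitary basis that makes [N] strictly lower triangular, pairing the
self-commutator with [diag (0, 1, ..., n - 1)] gives
[\sum_(i, j) (i - j) |N_ij|^2], which is at least [|N|^2]. *)
Lemma frob_self_commutator n (N : 'M[C]_n) :
  (forall a, eigenvalue N a -> a = 0) ->
  frob N ^+ 2 <=
    (\sum_(i < n) i%:R ^+ 2) * frob (N *m N^t* - N^t* *m N).
Proof.
have [n0|n0] := posnP n.
  by subst n; rewrite big_ord0 mul0r [N]flatmx0 /frob mul0mx mxtrace0 expr0n.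
move=> Nnil; have [P Pu Ptrig] := Schur N n0.
have Pun := unitarymx_unit Pu.
have PP : P^t* *m P = 1%:M by rewrite -invmx_unitary// mulVmx.
pose M := P *m N *m P^t*.
have {}Ptrig : is_trig_mx M by move: Ptrig; rewrite /similar_to conjymx.
have Mlow (i j : 'I_n) : (i <= j)%N -> M i j = 0.
  rewrite leq_eqVlt => /orP[/eqP/val_inj <-|]; last exact/is_trig_mxP.
  have : eigenvalue M (M i i).
    rewrite eigenvalue_root_char char_poly_trig// (bigD1 i)//=.
    by rewrite rootM root_XsubC eqxx.
  move=> /eigenvalueP[v vM v0]; apply: Nnil; apply/eigenvalueP.
  exists (v *m P).
    by rewrite scalemxAl -vM /M !mulmxA -[in RHS]mulmxA PP mulmx1.
  apply: contra_neq v0 => vP.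
  by rewrite -[v](mulmxK Pun) vP mul0mx.
have MME : M *m M^t* - M^t* *m M = P *m (N *m N^t* - N^t* *m N) *m P^t*.
  rewrite /M !trmxC_mul trmxCK mulmxBr mulmxBl !mulmxA; congr (_ - _).
    by rewrite -(mulmxA _ (P^t*) P) PP mulmx1.
  by rewrite -(mulmxA _ (P^t*) P) PP mulmx1.
rewrite -(frob_unitary N Pu) -[frob (_ - _)](frob_unitary _ Pu) -MME -/M.
pose D : 'M[C]_n := diag_mx (\row_i i%:R).
have DE (A : 'M[C]_n) : \tr (A *m D^t*) = \sum_i A i i * i%:R.
  apply: eq_bigr => i _; rewrite tr_diag_mx map_diag_mx mul_mx_diag !mxE.
  by rewrite rmorph_nat.
have -> : \sum_(i < n) i%:R ^+ 2 = frob D.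
  rewrite frobE; apply: eq_bigr => i _.
  rewrite (bigD1 i)//= big1 ?addr0.
    by rewrite !mxE eqxx mulr1n normr_nat.
  by move=> j ji; rewrite !mxE eq_sym (negbTE ji) mulr0n normr0 expr0n.
rewrite mulrC; apply: le_trans (frob_CauchySchwarz _ _).
have -> : \tr ((M *m M^t* - M^t* *m M) *m D^t*) =
    \sum_i \sum_j `|M i j| ^+ 2 * (i%:R - j%:R).
  rewrite DE.
  transitivity (\sum_i (\sum_j `|M i j| ^+ 2 * i%:R - \sum_j `|M j i| ^+ 2 * i%:R)).
    apply: eq_bigr => i _; rewrite -!mulr_suml -mulrBl; congr (_ * _).
    rewrite mxE [X in X + _]mxE [X in _ + X]mxE [X in - X]mxE; congr (_ - _);
      apply: eq_bigr => j _; rewrite !mxE ?normCK//.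
    by rewrite mulrC.
  rewrite sumrB [X in _ - X]exchange_big/= -sumrB; apply: eq_bigr => i _.
  by rewrite -sumrB; apply: eq_bigr => j _; rewrite mulrBr.
have frob_le : frob M <= \sum_i \sum_j `|M i j| ^+ 2 * (i%:R - j%:R).
  rewrite frobE; apply: ler_sum => i _; apply: ler_sum => j _.
  have [ij|ji] := leqP i j; first by rewrite Mlow// normr0 expr0n/= mul0r.
  by rewrite ler_peMr ?exprn_ge0// -natrB ?(ltnW ji)// ler1n subn_gt0.
rewrite [in leRHS]ger0_norm; last by rewrite (le_trans _ frob_le)// frob_ge0.
by rewrite ler_pXn2r// nnegrE ?frob_ge0// (le_trans _ frob_le)// frob_ge0.
Qed.

(** By the spectral theorem [H = U^* D U] with [D] diagonal and positive; take the
square root of [D] times [U]. *)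
Lemma posdef_gram n (H : 'M[C]_n) : H \is hermsymmx ->
  (forall v : 'cV[C]_n, v != 0 -> 0 < (v^t* *m H *m v) 0 0) ->
  exists2 P : 'M[C]_n, P \in unitmx & H = P^t* *m P.
Proof.
move=> Hh Hpos; have /hermitian_normalmx/orthomx_spectralP HE := Hh.
set U := spectralmx H in HE; set d := spectral_diag H in HE.
have Uu : U \is unitarymx by exact: spectral_unitarymx.
have UU : U *m U^t* = 1%:M by exact/unitarymxP.
rewrite invmx_unitary// in HE.
have dpos i : 0 < d 0 i.
  pose v : 'cV[C]_n := U^t* *m delta_mx i 0.
  have vE : v^t* *m U^t* = (delta_mx i 0)^t* :> 'rV[C]_n.
    by rewrite trmxC_mul trmxCK -mulmxA UU mulmx1.
  have := Hpos v; rewrite {1}HE !mulmxA vE.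
  rewrite /v -!mulmxA (mulmxA U) UU mul1mx.
  rewrite trmx_delta map_delta_mx mulmxA -rowE mxE.
  rewrite (bigD1 i)//= big1 ?addr0.
    rewrite !mxE !eqxx mulr1n mulr1; apply.
    apply/eqP => /(congr1 (mulmx U)); rewrite mulmxA UU mul1mx mulmx0.
    by move=> /matrixP/(_ i 0)/eqP; rewrite !mxE !eqxx/= oner_eq0.
  by move=> j ji; rewrite !mxE eq_sym (negbTE ji) mulr0n mul0r.
pose s := \row_i sqrtC (d 0 i).
exists (diag_mx s *m U).
  rewrite unitmx_mul (unitarymx_unit Uu) andbT unitmxE det_diag unitfE.
  by apply/prodf_neq0 => i _; rewrite mxE sqrtC_eq0 gt_eqF.
rewrite trmxC_mul mulmxA -(mulmxA _ _ (diag_mx s)) tr_diag_mx map_diag_mx mulmx_diag.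
rewrite {1}HE; congr (_ *m diag_mx _ *m _); apply/rowP => i; rewrite !mxE.
have sp : 0 <= sqrtC (d 0 i) by rewrite sqrtC_ge0 ltW.
by rewrite /= (CrealP (ger0_real sp)) -expr2 sqrtCK.
Qed.

End Frobenius.

(** * Norms of endomorphisms for a Hermitian metric *)

Section MetricNorm.
Variables (R : realType) (n : nat).
Local Notation C := R[i].
Implicit Types (A B N S T : 'M[C]_n).

(** The squared Hilbert-Schmidt norm on the endomorphisms of a Hermitian space. *)
Definition hnorm (H S : 'M[C]_n) : C := \tr (S *m adjoint H S).

Definition posdef (H : 'M[C]_n) : Prop :=
  H \is hermsymmx /\ forall v : 'cV[C]_n, v != 0 -> 0 < (v^t* *m H *m v) 0 0.

Lemma posdef_trmxC H : posdef H -> H^t* = H.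
Proof. by case=> /is_hermitianmxP; rewrite expr0 scale1r => /esym. Qed.

Lemma posdef_unit H : posdef H -> H \in unitmx.
Proof.
case=> Hh Hp; have [P Pu ->] := posdef_gram Hh Hp.
by rewrite unitmx_mul Pu andbT map_unitmx unitmx_tr.
Qed.

Lemma invmx_mul A B : A \in unitmx -> B \in unitmx ->
  invmx (A *m B) = invmx B *m invmx A.
Proof.
move=> Au Bu; have ABu : A *m B \in unitmx by rewrite unitmx_mul Au.
by rewrite -[RHS](mulKmx ABu) -(mulmxA A) mulKVmx// mulmxV// mulmx1.
Qed.

(** In an orthonormal basis the metric adjoint becomes the conjugate transpose,
which reduces metric norms to Frobenius norms. *)
Lemma posdef_orthonormal H : posdef H -> exists2 P : 'M[C]_n, P \in unitmx &
  forall S, P *m adjoint H S *m invmx P = (P *m S *m invmx P)^t*.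
Proof.
case=> Hh Hp; have [P Pu ->] := posdef_gram Hh Hp; exists P => // S.
have Pu' : P^t* \in unitmx by rewrite map_unitmx unitmx_tr.
rewrite /adjoint invmx_mul// !trmxC_mul invmx_trmxC !mulmxA.
by rewrite mulmxV// mul1mx mulmxK.
Qed.

Section Fixed.
Variable H : 'M[C]_n.
Hypothesis Hpos : posdef H.

Lemma hnorm_frob P : P \in unitmx ->
    (forall S, P *m adjoint H S *m invmx P = (P *m S *m invmx P)^t*) ->
  forall S, hnorm H S = frob (P *m S *m invmx P).
Proof.
move=> Pu PH S; rewrite /frob -PH /hnorm.
move: (adjoint H S) => X.
by rewrite !mulmxA (mulmxKV Pu) [in RHS]mxtrace_mulC !mulmxA (mulVmx Pu) mul1mx.
Qed.

Lemma hnorm_ge0 S : 0 <= hnorm H S.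
Proof.
by have [P Pu /(hnorm_frob Pu) ->] := posdef_orthonormal Hpos; exact: frob_ge0.
Qed.

Lemma hnorm_gt0 S : S != 0 -> 0 < hnorm H S.
Proof.
move=> S0; rewrite lt_neqAle hnorm_ge0 andbT eq_sym.
have [P Pu /(hnorm_frob Pu) ->] := posdef_orthonormal Hpos.
apply: contra_neq S0 => /frob_eq0 /(congr1 (fun X => invmx P *m X *m P)).
by rewrite !mulmxA mulVmx// mul1mx mulmxKV// mulmx0 mul0mx.
Qed.

Lemma hnormM S T : hnorm H (S *m T) <= hnorm H S * hnorm H T.
Proof.
have [P Pu /(hnorm_frob Pu) E] := posdef_orthonormal Hpos; rewrite !E.
apply: le_trans (frob_mulmx _ _).
by rewrite !mulmxA mulmxKV.
Qed.

Lemma hnorm_CauchySchwarz S T :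
  `|\tr (S *m adjoint H T)| ^+ 2 <= hnorm H S * hnorm H T.
Proof.
have [P Pu E] := posdef_orthonormal Hpos; rewrite !(hnorm_frob Pu E).
apply: le_trans (frob_CauchySchwarz _ _).
rewrite -E; move: (adjoint H T) => X.
rewrite !mulmxA (mulmxKV Pu) (mxtrace_mulC _ (invmx P)).
by rewrite !mulmxA (mulVmx Pu) mul1mx.
Qed.

Lemma hnorm_self_commutator N : (forall a, eigenvalue N a -> a = 0) ->
  hnorm H N ^+ 2 <= (\sum_(i < n) i%:R ^+ 2) *
    hnorm H (adjoint H N *m N - N *m adjoint H N).
Proof.
move=> Nnil; have [P Pu E] := posdef_orthonormal Hpos.
rewrite !(hnorm_frob Pu E).
have -> : P *m (adjoint H N *m N - N *m adjoint H N) *m invmx P =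
    - (P *m N *m invmx P *m (P *m N *m invmx P)^t* -
       (P *m N *m invmx P)^t* *m (P *m N *m invmx P)).
  by rewrite -!E; move: (adjoint H N) => X;
    rewrite opprB mulmxBr mulmxBl !mulmxA !(mulmxKV Pu).
rewrite frobN; apply: frob_self_commutator => a.
move=> /eigenvalueP[v vM v0]; apply: Nnil; apply/eigenvalueP.
exists (v *m P); first by rewrite scalemxAl -vM !mulmxA mulmxKV.
by apply: contra_neq v0 => vP; rewrite -[v](mulmxK Pu) vP mul0mx.
Qed.

End Fixed.
End MetricNorm.

(** * Bochner's formula *)

Section BochnerAlgebra.
Variables (F : comNzRingType) (n : nat).
Implicit Types A K G S X Y Z : 'M[F]_n.

Definition bracket_trace A S X : F := \tr ((A *m S - S *m A) *m X).

Lemma star_derivative_left K G A X : K *m G = 1%:M ->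
  (- (K *m (G *m A) *m K) *m X + K *m 0) *m G + K *m X *m (G *m A) =
  K *m X *m G *m A - A *m (K *m X *m G).
Proof.
move=> KG; rewrite mulmx0 addr0 !mulNmx addrC !mulmxA KG mul1mx.
by rewrite -!mulmxA.
Qed.

Lemma star_derivative_right K G A X : G *m K = 1%:M ->
  (- (K *m (A *m G) *m K) *m X + K *m 0) *m G + K *m X *m (A *m G) =
  K *m (X *m A - A *m X) *m G.
Proof.
move=> GK; rewrite mulmx0 addr0 mulmxBr mulmxBl addrC !mulNmx.
by rewrite !mulmxA -(mulmxA _ G K) GK mulmx1.
Qed.

(** The Jacobi identity turns the double bracket into [Y] bracketed with
[Z S - S Z], and cyclicity of the trace moves [Y] over to [X]. When [Z] and [X]
are the adjoints of [Y] and [S], the last two factors are adjoint to each other,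
so that the right-hand side is a square norm. *)
Lemma mxtrace_bracket S X Y Z : S *m Y = Y *m S ->
  bracket_trace (Y *m Z - Z *m Y) S X =
  \tr ((Z *m S - S *m Z) *m (X *m Y - Y *m X)).
Proof.
move=> SY; rewrite /bracket_trace !(mulmxBl, mulmxBr) !mulmxA.
have mxtrB (A B : 'M[F]_n) : \tr (A - B) = \tr A - \tr B by exact: raddfB.
have e1 : \tr (Z *m S *m X *m Y) = \tr (Y *m Z *m S *m X).
  by rewrite mxtrace_mulC !mulmxA.
have e2 : \tr (Z *m S *m Y *m X) = \tr (Z *m Y *m S *m X).
  by rewrite -(mulmxA Z) SY !mulmxA.
have e3 : \tr (S *m Z *m X *m Y) = \tr (S *m Y *m Z *m X).
  by rewrite mxtrace_mulC !mulmxA SY.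
rewrite !mxtrB e1 e2 e3; ring.
Qed.

Lemma mxtrace_bracketC S X A :
  \tr (0 *m X + S *m (X *m A - A *m X)) = bracket_trace A S X.
Proof.
rewrite /bracket_trace mul0mx add0r mulmxBr mulmxBl !raddfB/= !mulmxA; congr (_ - _).
by rewrite mxtrace_mulC mulmxA.
Qed.

Lemma mxtrace_dbar_bracket S X A Y Q :
  \tr ((Q *m S + A *m 0 + - (0 *m A + S *m Q)) *m X + Y) =
  bracket_trace Q S X + \tr Y.
Proof. by rewrite /bracket_trace mulmx0 mul0mx addr0 add0r mxtraceD. Qed.

End BochnerAlgebra.

Section Bochner.
Variables (R : realType) (n : nat).
Local Notation C := R[i].
Variables (U : set C) (H : C -> 'M[C]_n).
Hypothesis Uopen : open (U : set C^o).
Hypothesis Hpos : forall z, U z -> posdef (H z).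
Hypothesis H_c1 : forall z, U z -> mxc1 H z.
Hypothesis dH_c1 : forall z, U z -> mxc1 (mx_dz H) z.

Let nearU z : U z -> \forall w \near (z : C^o), U w.
Proof. by move=> Uz; exact: open_nbhs_nbhs. Qed.

Let conn (z : C) : 'M[C]_n := invmx (H z) *m mx_dz H z.

Let unit_near z : U z -> \forall w \near (z : C^o), H w \in unitmx.
Proof. by move/nearU; apply: filterS => w /Hpos/posdef_unit. Qed.

Lemma conn_c1 z : U z -> mxc1 conn z.
Proof.
by move=> Uz; apply: mxc1M (dH_c1 Uz); exact: mxc1V (unit_near Uz) (H_c1 Uz).
Qed.

Lemma mx_dzbar_posdef z : U z -> mx_dzbar H z = (mx_dz H z)^t*.
Proof.
move=> Uz; have h := mxc1_has_mxwirt (H_c1 Uz).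
have : has_mxwirt H z ((mx_dzbar H z)^t*) ((mx_dz H z)^t*).
  apply: has_mxwirt_near (has_mxwirt_conj h).
  by move: (nearU Uz); apply: filterS => w /Hpos/posdef_trmxC.
by move=> /has_mxwirt_derive[].
Qed.

Lemma mx_dzE z : U z -> mx_dz H z = H z *m conn z.
Proof. by move=> Uz; rewrite mulKVmx// posdef_unit//; exact: Hpos. Qed.

Lemma adjointM z (A B : 'M[C]_n) : U z ->
  adjoint (H z) (A *m B) = adjoint (H z) B *m adjoint (H z) A.
Proof.
move=> /Hpos/posdef_unit Hu.
by rewrite /adjoint trmxC_mul !mulmxA (mulmxK Hu).
Qed.

Lemma adjointB z (A B : 'M[C]_n) :
  adjoint (H z) (A - B) = adjoint (H z) A - adjoint (H z) B.
Proof. by rewrite /adjoint trmxCD trmxCN mulmxBr mulmxBl. Qed.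

Lemma adjointK z (A : 'M[C]_n) : U z -> adjoint (H z) (adjoint (H z) A) = A.
Proof.
move=> /Hpos Hz; have Hu := posdef_unit Hz; have Hh := posdef_trmxC Hz.
rewrite /adjoint !trmxC_mul trmxCK -invmx_trmxC Hh.
by rewrite !mulmxA (mulVmx Hu) mul1mx (mulmxKV Hu).
Qed.

Lemma adjoint_mxtrace z (A B : 'M[C]_n) : U z ->
  \tr (A *m adjoint (H z) B) = (\tr (B *m adjoint (H z) A))^*%C.
Proof.
move=> /Hpos/posdef_trmxC Hh.
rewrite -[RHS]mxtrace_trmxC /adjoint !trmxC_mul trmxCK -invmx_trmxC Hh.
by rewrite -!mulmxA [RHS]mxtrace_mulC !mulmxA.
Qed.

Lemma has_mxwirt_eq m p (A : C -> 'M[C]_(m, p)) z a b a' b' :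
  has_mxwirt A z a b -> a = a' -> b = b' -> has_mxwirt A z a' b'.
Proof. by move=> ? <- <-. Qed.

Lemma has_wirt_eq (f : C -> C) z a b a' b' :
  has_wirt f z a b -> a = a' -> b = b' -> has_wirt f z a' b'.
Proof. by move=> ? <- <-. Qed.

(** The first derivative says that the adjoint of a constant section is covariantly
constant in the direction [dz]; the second is the adjoint of the covariant
derivative of the section. *)
Lemma has_mxwirt_adjoint z S : U z ->
  has_mxwirt (fun w => adjoint (H w) S) z
    (adjoint (H z) S *m conn z - conn z *m adjoint (H z) S)
    (adjoint (H z) (conn z *m S - S *m conn z)).
Proof.
move=> Uz; have Hu := posdef_unit (Hpos Uz).
have h := mxc1_has_mxwirt (H_c1 Uz).
have k := has_mxwirtV (unit_near Uz) (H_c1 Uz) h.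
have dH := mx_dzE Uz; have dbH : mx_dzbar H z = (conn z)^t* *m H z.
  by rewrite (mx_dzbar_posdef Uz) dH trmxC_mul (posdef_trmxC (Hpos Uz)).
apply: (has_mxwirt_eq (has_mxwirtM (has_mxwirtM k (has_mxwirt_cst (S^t*) z)) h)).
  by rewrite dH; exact: star_derivative_left (mulVmx Hu).
have -> : adjoint (H z) (conn z *m S - S *m conn z) =
    invmx (H z) *m (S^t* *m (conn z)^t* - (conn z)^t* *m S^t*) *m H z.
  by rewrite /adjoint trmxCD trmxCN !trmxC_mul.
rewrite dbH; exact: star_derivative_right (mulmxV Hu).
Qed.

Variable T : C -> 'M[C]_n.
Hypothesis harm : forall z, U z -> curvature (chern_form H) z +
  (T z *m adjoint (H z) (T z) - adjoint (H z) (T z) *m T z) = 0.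

(** In a holomorphic frame the Chern curvature is [- d/dzbar] of the connection
form, so harmonicity prescribes this derivative. *)
Lemma mx_dzbar_conn z : U z -> mx_dzbar conn z =
  T z *m adjoint (H z) (T z) - adjoint (H z) (T z) *m T z.
Proof.
move=> /harm; rewrite /curvature /chern_form /= mulmx0 mul0mx subrr addr0.
have [-> _] := has_mxwirt_derive (has_mxwirt_cst (0 : 'M[C]_n) z).
by rewrite sub0r => /eqP; rewrite addrC subr_eq0 => /eqP.
Qed.

Variable S : 'M[C]_n.
Hypothesis ST : forall z, U z -> S *m T z = T z *m S.

Let nabla (z : C) : 'M[C]_n := conn z *m S - S *m conn z.

(** The [d/dz]-derivative of the square norm of [S]: the inner product of the
covariant derivative of [S] with [S]. *)
Definition dz_hnorm (z : C) : C := \tr (nabla z *m adjoint (H z) S).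

Lemma mxtrace_curvature_bracket z : U z ->
  let Ts := adjoint (H z) (T z) in
  bracket_trace (mx_dzbar conn z) S (adjoint (H z) S) =
  hnorm (H z) (Ts *m S - S *m Ts).
Proof.
move=> Uz Ts; have TsK : adjoint (H z) Ts = T z by exact: adjointK.
have -> : mx_dzbar conn z = T z *m Ts - Ts *m T z by exact: mx_dzbar_conn.
rewrite /hnorm adjointB (adjointM Ts S Uz) (adjointM S Ts Uz) TsK.
by rewrite mxtrace_bracket//; exact: ST.
Qed.

(** Bochner's formula for a section [S] of the endomorphism bundle that is constant
in the holomorphic frame and commutes with the Higgs field. With [b] the
[d/dzbar d/dz]-derivative of [|S|^2], it says that
[b = |nabla S|^2 + |[T^*, S]|^2], and the Cauchy-Schwarz inequality bounds
[|dz_hnorm|^2] by [|nabla S|^2 |S|^2]. *)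
Lemma bochner z : U z ->
  [/\ c1 (fun w => hnorm (H w) S) z,
      has_wirt (fun w => hnorm (H w) S) z (dz_hnorm z) (dz_hnorm z)^*%C &
      exists a b, [/\ has_wirt dz_hnorm z a b, 0 <= b &
        `|dz_hnorm z| ^+ 2 + hnorm (H z) S * hnorm (H z)
          (adjoint (H z) (T z) *m S - S *m adjoint (H z) (T z))
        <= hnorm (H z) S * b]].
Proof.
move=> Uz.
have adj := has_mxwirt_adjoint S Uz.
have cst := has_mxwirt_cst S z.
split.
- apply: c1_mxtrace; apply: mxc1M; first exact: mxc1_cst.
  apply: mxc1M; last exact: H_c1.
  apply: mxc1M; last exact: mxc1_cst.
  exact: mxc1V (unit_near Uz) (H_c1 Uz).
- apply: (has_wirt_eq (has_wirt_mxtrace (has_mxwirtM cst adj))).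
    exact: mxtrace_bracketC.
  by rewrite mul0mx add0r /dz_hnorm -adjoint_mxtrace.
pose dn := hnorm (H z) (nabla z).
set X := _ - S *m adjoint (H z) (T z).
have hc := mxc1_has_mxwirt (conn_c1 Uz).
have dd := has_wirt_mxtrace (has_mxwirtM
  (has_mxwirtD (has_mxwirtM hc cst) (has_mxwirtN (has_mxwirtM cst hc))) adj).
eexists; exists (hnorm (H z) X + dn); split.
- apply: (has_wirt_eq dd (erefl _)).
  by rewrite mxtrace_dbar_bracket (mxtrace_curvature_bracket Uz).
- by rewrite addr_ge0// hnorm_ge0//; exact: Hpos.
rewrite mulrDr addrC lerD2l mulrC.
exact: hnorm_CauchySchwarz (Hpos Uz) _ _.
Qed.

End Bochner.

(** * Maximum principle and Ahlfors-Schwarz lemma *)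

Section ScalarMaximumPrinciples.
Variable R : realType.
Local Notation C := R[i].
Implicit Types (f df : C -> C) (z p a b : C).

Lemma conjcD (x y : C) : (x + y)^*%C = x^*%C + y^*%C.
Proof. exact: rmorphD. Qed.

Lemma conjcM (x y : C) : (x * y)^*%C = x^*%C * y^*%C.
Proof. exact: rmorphM. Qed.

Lemma conjcN (x : C) : (- x)^*%C = - x^*%C.
Proof. exact: rmorphN. Qed.

Lemma real_complexM (x y : R) : (x * y)%:C = x%:C * y%:C.
Proof. exact: rmorphM. Qed.

Lemma real_complexB (x y : R) : (x - y)%:C = x%:C - y%:C.
Proof. exact: rmorphB. Qed.

Lemma real_complexN (x : R) : (- x)%:C = - x%:C.
Proof. exact: rmorphN. Qed.

Lemma real_complex_nat n : (n%:R : R)%:C = n%:R.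
Proof. exact: rmorph_nat. Qed.

Lemma continuous_Re : continuous (fun z : C^o => complex.Re z : R).
Proof.
move=> z; apply/(@cvgrPdist_lt R R^o _ (nbhs (z : C^o)) (nbhs_filter _)) => e e0.
near=> w.
rewrite -ltcR; apply: le_lt_trans (_ : `|z - w| < e%:C).
  by rewrite (le_trans _ (normc_ge_Re _))// lecR; case: (z) (w) => [? ?] [? ?].
near: w; apply: (@cvgr_dist_lt C C^o _ _ _ id z) => //.
by rewrite ltcR.
Unshelve. all: by end_near. Qed.

Lemma c1_Re_continuous f z : c1 f z ->
  {for z, continuous (fun w : C^o => complex.Re (f w) : R)}.
Proof.
case=> f0 _; exact: (@cvg_comp _ _ _ (f : C^o -> C^o)
  (fun w : C^o => complex.Re w : R) _ _ _ f0 (@continuous_Re (f z))).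
Qed.

Lemma open_disc p (r : R) : open ([set w : C | `|w - p| < r%:C] : set C^o).
Proof.
rewrite (_ : [set _ | _] = ball (p : C^o) r%:C); first exact: ball_open.
by apply/seteqP; split => w; rewrite /ball/= distrC.
Qed.

Lemma has_wirt_id z : has_wirt (fun w => w) z 1 0.
Proof.
have dt (x y : R) : is_derive (0 : R) (1 : R) (fun t : R => x + t * y) y.
  have := is_deriveD (is_derive_cst x (0 : R) (1 : R))
    (is_deriveM (is_derive_id (0 : R) (1 : R)) (is_derive_cst y (0 : R) (1 : R))).
  by rewrite scaler0 !add0r /GRing.scale/= mulr1.
by split; split; rewrite /along; case: z => x y /=;
  [have := dt x 1|have := dt y 0|have := dt x 0|have := dt y 1];
  congr (is_derive _ _ _ _); try (apply/funext => t /=); ring.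
Qed.

Lemma c1_id z : c1 (fun w => w) z.
Proof.
split; first exact: (@cvg_id _ (nbhs (z : C^o))).
by exists 1, 0; exact: has_wirt_id.
Qed.

Lemma ge0_real (x : C) : 0 <= x -> x = (complex.Re x)%:C.
Proof. by move=> x0; rewrite RRe_real// ger0_real. Qed.

(** Adding [d |z|^2] makes the Laplacian positive, which excludes an interior
maximum; then [d] tends to zero. *)
Lemma subharmonic_le (U : set C) f df (r B : R) : 0 < r ->
  (forall w, `|w| <= r%:C -> U w) ->
  (forall w, U w -> [/\ c1 f w, has_wirt f w (df w) (df w)^*%C &
     exists a b, has_wirt df w a b /\ 0 <= b]) ->
  (forall w, `|w| = r%:C -> complex.Re (f w) <= B) -> complex.Re (f 0) <= B.
Proof.
move=> r0 rU fU fB.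
suff H (d : R) : 0 < d -> complex.Re (f 0) <= B + d * r ^+ 2.
  apply/ler_addgt0Pr => e e0; have := H (e / r ^+ 2).
  by rewrite divfK ?expf_neq0 ?gt_eqF//; apply; rewrite divr_gt0// exprn_gt0.
move=> d0.
pose g w := f w + d%:C * (w * w^*%C).
have gE w : complex.Re (g w) = complex.Re (f w) + d * complex.Re (`|w| ^+ 2).
  by rewrite /g -sqr_normc Re_addc Re_mulc [complex.Im d%:C]/= mul0r subr0.
pose dg w := df w + d%:C * w^*%C.
have nb w : `|w - 0| <= r%:C -> `|w| <= r%:C by rewrite subr0.
have [c cr cmax] : exists2 c, `|c - 0| <= r%:C & forall w, `|w - 0| <= r%:C ->
    complex.Re (g w) <= complex.Re (g c).
  apply: (@disc_max R (fun w => complex.Re (g w)) 0 r (ltW r0)) => w /nb/rU/fU[f1 _ _].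
  apply: c1_Re_continuous; apply: c1D => //; apply: c1M; first exact: c1_cst.
  by apply: c1M; [exact: c1_id|apply: c1_conj; exact: c1_id].
have [ceq|cneq] := eqVneq `|c| r%:C.
  have := cmax 0; rewrite subr0 normr0 lecR => /(_ (ltW r0)).
  have n0 : complex.Re (`|0 : C| ^+ 2) = 0 by rewrite normr0 expr0n.
  have nc : complex.Re (`|c| ^+ 2) = r ^+ 2 by rewrite ceq -rmorphXn.
  rewrite !gE n0 nc mulr0 addr0 => /le_trans; apply.
  by rewrite lerD2r; exact: fB.
exfalso.
have cr' : `|c| < r%:C by rewrite lt_neqAle cneq nb.
have Uc := rU c (ltW cr'); have [_ _ [a [b [dfc b0]]]] := fU c Uc.
have wsq w : has_wirt (fun w => d%:C * w^*%C) w 0 d%:C.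
  have := has_wirtM (has_wirt_cst w d%:C) (has_wirt_conj (has_wirt_id w)).
  by rewrite !mul0r !add0r conjc0 conjc1 mulr0 mulr1.
have [] := @wirt_max_test R [set w | `|w - 0| < r%:C] g dg c (a + 0) (b + d%:C).
- exact: open_disc.
- by rewrite /= subr0.
- move=> w /= wr; have Uw : U w by apply: rU; rewrite -[w]subr0 ltW.
  have [_ fw _] := fU w Uw.
  have := has_wirtD fw (has_wirtM (has_wirt_cst w d%:C)
    (has_wirtM (has_wirt_id w) (has_wirt_conj (has_wirt_id w)))).
  congr (has_wirt _ _ _ _).
    by rewrite /dg conjc0; ring.
  by rewrite /dg conjc1 conjcD conjcM conjc_real conjcK; ring.
- exact: has_wirtD.
- by move=> w /= /ltW; exact: cmax.
- move=> _; rewrite Re_addc/= leNgt => /negP; apply.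
  by rewrite ltr_wpDl//; move: b0; rewrite lecE => /andP[].
Qed.

(** The Ahlfors-Schwarz lemma. Where [f] is positive, the last hypothesis says that
the Laplacian of [log f] is at least [4 m f]. The function
[f * (e^2 - |z - p|^2)^2] vanishes on the boundary circle, so its maximum is
attained inside, where the maximum test bounds it. *)
Lemma ahlfors_schwarz (U : set C) f df p (e m : R) : 0 < e -> 0 < m ->
  (forall w, `|w - p| <= e%:C -> U w) ->
  (forall w, U w -> 0 <= f w) ->
  (forall w, U w -> c1 f w /\ has_wirt f w (df w) (df w)^*%C) ->
  (forall w, `|w - p| <= e%:C -> exists a b, has_wirt df w a b /\
     `|df w| ^+ 2 + m%:C * f w ^+ 3 <= f w * b) ->
  m * complex.Re (f p) * e ^+ 2 <= 2.
Proof.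
move=> e0 m0 eU f0 fU fine.
have Up : U p by apply: eU; rewrite subrr normr0 lecR ltW.
have [fp0|fp0] := leP (complex.Re (f p)) 0.
  rewrite (@le_trans _ _ 0)// -mulrA pmulr_rle0// pmulr_lle0// exprn_gt0//.
pose w (z : C) := (e ^+ 2)%:C - (z - p) * (z - p)^*%C.
have wE z : w z = (e ^+ 2 - complex.Re (`|z - p| ^+ 2))%:C.
  rewrite /w -sqr_normc {1}(ge0_real (exprn_ge0 2 (normr_ge0 (z - p)))).
  by rewrite -rmorphB.
pose g z := f z * (w z * w z).
have gE z : U z -> complex.Re (g z) =
    complex.Re (f z) * (e ^+ 2 - complex.Re (`|z - p| ^+ 2)) ^+ 2.
  by move=> /f0/ge0_real fz; rewrite /g wE fz -!rmorphM/= expr2.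
have c1w z : c1 w z.
  have c1zp : c1 (fun z => z - p) z by apply: c1D; [exact: c1_id|exact: c1_cst].
  apply: c1D; first exact: c1_cst.
  have := c1M (c1_cst (-1) z) (c1M c1zp (c1_conj c1zp)).
  by under eq_fun do rewrite mulN1r.
have dzp z : has_wirt (fun z => z - p) z 1 0.
  by have := has_wirtD (has_wirt_id z) (has_wirt_cst z (- p)); rewrite !addr0.
have dzpJ z : has_wirt (fun z => - (z - p)^*%C) z 0 (-1).
  have := has_wirtM (has_wirt_cst z (-1)) (has_wirt_conj (dzp z)).
  rewrite conjc0 conjc1 !mul0r mulr0 mulr1 !add0r.
  by under eq_fun do rewrite mulN1r.
have dw z : has_wirt w z (- (z - p)^*%C) (- (z - p)).
  have := has_wirtD (has_wirt_cst z (e ^+ 2)%:C) (has_wirtM (dzp z) (dzpJ z)).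
  rewrite mul1r mulr0 mul0r mulrN1 !add0r addr0.
  by under eq_fun do rewrite mulrN.
pose dg z := df z * (w z * w z) + f z * (- (z - p)^*%C * w z + w z * - (z - p)^*%C).
have [c ce cmax] : exists2 c, `|c - p| <= e%:C & forall z, `|z - p| <= e%:C ->
    complex.Re (g z) <= complex.Re (g c).
  apply: (@disc_max R (fun z => complex.Re (g z)) p e (ltW e0)) => z /eU/fU[f1 _].
  by apply: c1_Re_continuous; apply: c1M => //; exact: c1M.
have Uc := eU c ce.
set F := complex.Re (f c); pose Z := complex.Re (`|c - p| ^+ 2).
pose W := e ^+ 2 - Z.
have fE : f c = F%:C by rewrite /F -ge0_real//; exact: f0.
have wcE : w c = W%:C by exact: wE.
have ZE : (c - p) * (c - p)^*%C = Z%:C.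
  by rewrite -sqr_normc /Z -ge0_real// exprn_ge0.
have Z0 : 0 <= Z.
  have : 0 <= `|c - p| ^+ 2 by rewrite exprn_ge0.
  by rewrite /Z lecE => /andP[].
have gc : complex.Re (f p) * (e ^+ 2) ^+ 2 <= F * W ^+ 2.
  have := cmax p; rewrite !gE// subrr normr0 lecR => /(_ (ltW e0)).
  by rewrite expr0n/= subr0.
have FW0 : 0 < F * W ^+ 2.
  by rewrite (lt_le_trans _ gc)// mulr_gt0// !exprn_gt0.
have W0 : W != 0 by apply: contraTneq FW0 => ->; rewrite expr0n/= mulr0 ltxx.
have F0 : 0 < F by move: FW0; rewrite pmulr_lgt0// exprn_even_gt0.
have ce' : `|c - p| < e%:C.
  rewrite lt_neqAle ce andbT; apply: contra_neq W0 => h.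
  by rewrite /W /Z h -rmorphXn/= subrr.
have [a [b [dfc ineq]]] := fine c ce.
have d1 := has_wirtM dfc (has_wirtM (dw c) (dw c)).
have d2 := has_wirtM (proj2 (fU c Uc))
  (has_wirtD (has_wirtM (dzpJ c) (dw c)) (has_wirtM (dw c) (dzpJ c))).
have [] := @wirt_max_test R [set z | `|z - p| < e%:C] g dg c _ _ _ _ _
  (has_wirtD d1 d2).
- exact: open_disc.
- by [].
- move=> z /= /ltW/eU Uz; have [_ fz] := fU z Uz.
  have := has_wirtM fz (has_wirtM (dw z) (dw z)).
  congr (has_wirt _ _ _ _).
  have wJ : (w z)^*%C = w z by rewrite wE conjc_real.
  have fJ : (f z)^*%C = f z by rewrite (ge0_real (f0 z Uz)) conjc_real.
  rewrite /dg; move: (z - p) (w z) (f z) (df z) wJ fJ => zeta1 w1 f1 u1 wJ fJ.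
  by rewrite !(conjcD, conjcM, conjcN) wJ fJ conjcK.
- by move=> z /= /ltW; exact: cmax.
rewrite /dg fE wcE; set zeta := c - p.
rewrite -/zeta in ZE; rewrite {}fE in ineq; move: ineq dfc d1 d2.
move: (df c) => u ineq _ _ _ du reB.
(* The gradient of [g] vanishes at [c]; this determines [df c]. *)
have uW : u * W%:C = 2 * F%:C * zeta^*%C.
  have W0' : W%:C != 0 :> C by rewrite fmorph_eq0.
  apply/eqP; rewrite -subr_eq0 -(mulIr_eq0 _ (mulIf W0')); apply/eqP.
  by rewrite -[RHS]du; ring.
have uN : complex.Re (`|u| ^+ 2) * W ^+ 2 = 4 * F ^+ 2 * Z.
  have E : `|u| ^+ 2 * (W ^+ 2)%:C = (4 * F ^+ 2 * Z)%:C.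
    have -> : `|u| ^+ 2 * (W ^+ 2)%:C = (u * W%:C) * (u * W%:C)^*%C.
      by rewrite sqr_normc conjcM conjc_real expr2 rmorphM; ring.
    rewrite uW !conjcM conjcK conjc_real conjc_nat !real_complexM.
    by rewrite real_complex_nat -ZE; ring.
  have := congr1 (@complex.Re R) E.
  by rewrite (Re_mulc (`|u| ^+ 2)) [complex.Im (W ^+ 2)%:C]/= mulr0 subr0.
have {}ineq : complex.Re (`|u| ^+ 2) + m * F ^+ 3 <= F * complex.Re b.
  move: ineq; rewrite lecE => /andP[_].
  have -> : m%:C * F%:C ^+ 3 = (m * F ^+ 3)%:C by rewrite real_complexM rmorphXn.
  by rewrite Re_addc (Re_mulc F%:C b) [complex.Im F%:C]/= mul0r subr0.
have uWJ : u^*%C * W%:C = 2 * F%:C * zeta.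
  have := congr1 (@conjc R) uW.
  by rewrite !conjcM conjcK !conjc_real conjc_nat.
(* The condition on the second derivative of [g] at [c], with [df c] eliminated. *)
have {}reB : complex.Re b * W ^+ 2 - 6 * F * Z - 2 * F * W <= 0.
  apply: le_trans reB; rewrite le_eqVlt; apply/orP; left; apply/eqP.
  transitivity (complex.Re (b * (W ^+ 2)%:C + (- 6 * F * Z - 2 * F * W)%:C)).
    by rewrite Re_addc Re_mulc/= mulr0 subr0; ring.
  congr complex.Re.
  transitivity (b * (W%:C * W%:C) - 2 * (u * W%:C) * zeta
    - 2 * (u^*%C * W%:C) * zeta^*%C
    + F%:C * (2 * (zeta * zeta^*%C) - 2 * W%:C)); last by ring.
  rewrite uW uWJ.
  transitivity (b * (W%:C * W%:C) - 6 * F%:C * (zeta * zeta^*%C) - 2 * F%:C * W%:C);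
    last by ring.
  by rewrite ZE expr2 real_complexB !real_complexM real_complexN !real_complex_nat; ring.
have step : m * F * W ^+ 2 <= 2 * e ^+ 2.
  have h1 : (complex.Re (`|u| ^+ 2) + m * F ^+ 3) * W ^+ 2 <= F * complex.Re b * W ^+ 2.
    by rewrite ler_wpM2r// sqr_ge0.
  have h2 : F * (complex.Re b * W ^+ 2 - 6 * F * Z - 2 * F * W) <= 0.
    by rewrite pmulr_rle0.
  have h3 : F ^+ 2 * (m * F * W ^+ 2 - 2 * e ^+ 2) <= 0.
    by move: h1 h2; rewrite mulrDl uN /W => h1 h2; nra.
  by move: h3; rewrite pmulr_rle0 ?exprn_gt0// subr_le0.
have e2 : 0 < e ^+ 2 by rewrite exprn_gt0.
rewrite -(ler_pM2r e2); apply: le_trans step.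
have -> : m * complex.Re (f p) * e ^+ 2 * e ^+ 2 =
    m * (complex.Re (f p) * (e ^+ 2) ^+ 2) by ring.
by rewrite -(mulrA m) ler_pM2l.
Qed.

End ScalarMaximumPrinciples.

(** * A lacunary series growing fast on circles *)

Section LacunarySeries.
Variable R : realType.
Local Notation C := R[i].

(** The modulus with values in [R], where the order is total. *)
Definition cabs (z : C) : R := complex.Re `|z|.

Lemma normE (z : C) : `|z| = (cabs z)%:C.
Proof. exact/ge0_real/normr_ge0. Qed.

Lemma cabs_ge0 (z : C) : 0 <= cabs z.
Proof. by rewrite -lecR -normE normr_ge0. Qed.

Lemma cabsM (x y : C) : cabs (x * y) = cabs x * cabs y.
Proof. by apply: (@complexI R); rewrite real_complexM -!normE normrM. Qed.

Lemma cabsX (x : C) n : cabs (x ^+ n) = cabs x ^+ n.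
Proof. by apply: (@complexI R); rewrite rmorphXn -!normE normrX. Qed.

Lemma cabsD (x y : C) : cabs (x + y) <= cabs x + cabs y.
Proof. by rewrite -lecR rmorphD -!normE ler_normD. Qed.

Lemma cabsN (x : C) : cabs (- x) = cabs x.
Proof. by rewrite /cabs normrN. Qed.

Lemma cabs0 : cabs 0 = 0.
Proof. by rewrite /cabs normr0. Qed.

Lemma cabs_nat n : cabs n%:R = n%:R.
Proof. by rewrite /cabs normr_nat -real_complex_nat. Qed.

Lemma cabs_sum (I : Type) (r : seq I) (P : pred I) (F : I -> C) :
  cabs (\sum_(i <- r | P i) F i) <= \sum_(i <- r | P i) cabs (F i).
Proof.
elim/big_ind2 : _ => // [|x1 x2 y1 y2 h1 h2]; first by rewrite cabs0.
by rewrite (le_trans (cabsD _ _))// lerD.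
Qed.

Lemma cabs_Re_Im (z : C) : [/\ `|complex.Re z| <= cabs z, `|complex.Im z| <= cabs z &
  cabs z <= `|complex.Re z| + `|complex.Im z|].
Proof.
rewrite /cabs normc_def /=; split.
- by rewrite -sqrtr_sqr ler_wsqrtr// lerDl sqr_ge0.
- by rewrite -sqrtr_sqr ler_wsqrtr// lerDr sqr_ge0.
- rewrite -[leRHS]ger0_norm ?addr_ge0// -sqrtr_sqr ler_wsqrtr//.
  by rewrite sqrrD !real_normK ?num_real// addrAC lerDl mulrn_wge0 ?mulr_ge0.
Qed.

Lemma le_geometric_error (x y b : R) :
  (forall n, x <= y + b * 2 ^- n) -> x <= y.
Proof.
move=> h; apply/ler_addgt0Pr => e e0.
have [b0|b0] := leP b 0.
  rewrite (le_trans (h 0%N))// lerD2l expr0 invr1 mulr1; exact: le_trans b0 (ltW e0).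
have : (fun n : nat => b * (2^-1 : R) ^+ n) @ \oo --> (b * 0 : R).
  apply: cvgM; first exact: cvg_cst.
  by apply: cvg_expr; rewrite ger0_norm// invf_lt1// ltr1n.
rewrite mulr0 => /cvgr_lt/(_ _ e0) [n _ /(_ n (leqnn n))/= ne].
by rewrite (le_trans (h n))// lerD2l -exprVn ltW.
Qed.

Lemma sum_half n : \sum_(k < n) 2 ^- k <= 2 :> R.
Proof.
have -> : \sum_(k < n) 2 ^- k = 2 - 2 * 2 ^- n :> R.
  elim: n => [|n IH]; first by rewrite big_ord0 expr0 invr1 mulr1 subrr.
  by rewrite big_ord_recr/= IH exprS invfM; field; rewrite expf_neq0.
by rewrite gerBl mulr_ge0// invr_ge0 exprn_ge0.
Qed.

Lemma series_limit (u : nat -> R) (b : R) : (forall k, `|u k| <= b * 2 ^- k) ->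
  forall n, `|limn (series u) - \sum_(k < n) u k| <= 2 * b * 2 ^- n.
Proof.
move=> ub.
have tail n d : `|series u (n + d)%N - series u n| <= 2 * b * (2 ^- n - 2 ^- (n + d)).
  elim: d => [|d IH]; first by rewrite addn0 !subrr mulr0 normr0.
  have -> : series u (n + d.+1)%N - series u n =
      (series u (n + d)%N - series u n) + u (n + d)%N.
    by rewrite /series/= addnS big_nat_recr//= addrAC.
  rewrite (le_trans (ler_normD _ _))//.
  rewrite (le_trans (lerD IH (ub _)))// addnS le_eqVlt; apply/orP; left; apply/eqP.
  by rewrite exprSr invfM; field; rewrite !expf_neq0.
have b0 : 0 <= b by have := ub 0%N; rewrite expr0 invr1 mulr1; apply: le_trans.
have cvu : cvgn (series u).
  apply: normed_cvg; apply: (@series_le_cvg _ _ (geometric b 2^-1)).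
  - by move=> k /=.
  - by move=> k /=; rewrite mulr_ge0// exprn_ge0.
  - by move=> k /=; rewrite exprVn.
  - by apply: is_cvg_geometric_series; rewrite ger0_norm// invf_lt1// ltr1n.
move=> n.
have : (fun d => `|series u (n + d)%N - series u n|) @ \oo -->
    `|limn (series u) - series u n|.
  apply: cvg_norm; apply: cvgB; last exact: cvg_cst.
  exact: (cvg_comp (addn n) (series u) (@cvg_addnl n) cvu).
move=> h; rewrite [X in _ - X](_ : _ = series u n); last first.
  by rewrite /series/= big_mkord.
rewrite -(cvg_lim _ h)//; apply: limr_le; first by apply/cvg_ex; eexists; exact: h.
apply: nearW => d; rewrite (le_trans (tail n d))// ler_wpM2l ?mulr_ge0//.
by rewrite gerBl invr_ge0 exprn_ge0.
Qed.

(** Summing real and imaginary parts separately reduces convergence to the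
completeness of [R]. *)
Definition csum (a : nat -> C) : C :=
  limn (series (fun k => complex.Re (a k))) +i*
  limn (series (fun k => complex.Im (a k))).

Lemma csum_tail (a : nat -> C) (b : R) : (forall k, cabs (a k) <= b * 2 ^- k) ->
  forall n, cabs (csum a - \sum_(k < n) a k) <= 4 * b * 2 ^- n.
Proof.
move=> ab n.
have ReS : complex.Re (\sum_(k < n) a k) = \sum_(k < n) complex.Re (a k).
  by apply: big_morph; [exact: Re_addc|].
have ImS : complex.Im (\sum_(k < n) a k) = \sum_(k < n) complex.Im (a k).
  by apply: big_morph; [exact: Im_addc|].
have [_ _ /le_trans] := cabs_Re_Im (csum a - \sum_(k < n) a k); apply.
have ReN (x : C) : complex.Re (- x) = - complex.Re x by case: x.
have ImN (x : C) : complex.Im (- x) = - complex.Im x by case: x.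
rewrite Re_addc Im_addc ReN ImN ReS ImS.
have h1 := @series_limit (fun k => complex.Re (a k)) b _ n.
have h2 := @series_limit (fun k => complex.Im (a k)) b _ n.
rewrite (_ : 4 * b * 2 ^- n = 2 * b * 2 ^- n + 2 * b * 2 ^- n); last by ring.
apply: lerD; [apply: h1|apply: h2] => k;
  by have [? ? _] := cabs_Re_Im (a k); exact: le_trans (ab k).
Qed.

Section Lacunary.

(** [\sum_k 100^k z^(32^k)].  On the circles where [|z|^(32^k)] is of moderate
size the [k]-th term dominates all the others, and [100^k] outgrows the inverse
distance [32^k] of these circles to the boundary. *)
Definition lacunary_term (k : nat) (z : C) : C := 100 ^+ k * z ^+ (32 ^ k).
Definition lacunary (z : C) : C := csum (lacunary_term ^~ z).

Definition lacunary_term' (k : nat) (z : C) : C :=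
  100 ^+ k * ((32 ^ k)%:R * z ^+ (32 ^ k).-1).
Definition lacunary' (z : C) : C := csum (lacunary_term' ^~ z).

Lemma sqr_le_32expn k : (k * k <= 32 ^ k)%N.
Proof.
case: k => // k; have k5 : (k.+1 <= 5 ^ k.+1)%N by exact/ltnW/ltn_expl.
by rewrite (leq_trans (leq_mul k5 k5))// -expnMn leq_exp2r.
Qed.

(** One majorant serves for the series, its derivative and the second-order
remainder: the factor [(32 ^ k)^2] is what differentiating twice produces. *)
Lemma lacunary_majorant (r : R) : 0 <= r -> r < 1 ->
  exists2 A : R, 0 <= A &
    forall k, 100 ^+ k * (32 ^ k)%:R ^+ 2 * r ^+ (32 ^ k) <= A * 2 ^- k.
Proof.
move=> r0 r1; pose q : R := 100 * 32 ^+ 2 * 2.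
have [K qK] : exists K : nat, q * r ^+ K <= 1.
  have : (fun n : nat => q * r ^+ n) @ \oo --> (q * 0 : R).
    by apply: cvgM; [exact: cvg_cst|apply: cvg_expr; rewrite ger0_norm].
  rewrite mulr0 => /cvgr_lt/(_ _ ltr01) [n _ /(_ n (leqnn n))/= h].
  by exists n; exact: ltW.
have q1 : 1 <= q by rewrite /q; lra.
have q0 : 0 <= q by rewrite (le_trans _ q1).
(* [q ^+ k] collects [100 ^+ k], the square of [32 ^ k], and the required [2 ^+ k];
   since [k * K <= 32 ^ k] for [K <= k], the power of [r] absorbs it. *)
have qE k : 100 ^+ k * (32 ^ k)%:R ^+ 2 * r ^+ (32 ^ k) * 2 ^+ k =
    q ^+ k * r ^+ (32 ^ k).
  by rewrite natrX -exprM mulnC exprM mulrAC -!exprMn.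
clearbody q; exists (q ^+ K); first exact: exprn_ge0.
move=> k; rewrite ler_pdivlMr ?exprn_gt0// qE.
have [kK|Kk] := leqP k K.
  rewrite (le_trans (_ : _ <= q ^+ k * 1))//.
    by rewrite ler_wpM2l ?exprn_ge0// exprn_ile1// ltW.
  by rewrite mulr1 ler_weXn2l.
rewrite (le_trans (_ : _ <= (q * r ^+ K) ^+ k))//.
  rewrite exprMn ler_wpM2l ?exprn_ge0// -exprM.
  apply: ler_wiXn2l => //; first exact: ltW.
  by rewrite (leq_trans _ (sqr_le_32expn k))// leq_mul2r ltnW// orbT.
rewrite (@le_trans _ _ 1)// ?exprn_ile1 ?mulr_ge0 ?exprn_ge0//.
exact: exprn_ege1.
Qed.

(** Induction on [n].  Assuming [1 / 2 <= r] allows the bound to be written with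
[r ^+ n] instead of [r ^+ (n - 2)], because then [r ^+ (n - 1)] is at most
[4 * r ^+ (n + 1)]. *)
Lemma cabs_taylor_monomial (z h : C) (r : R) n : 1 / 2 <= r ->
  cabs z <= r -> cabs (z + h) <= r ->
  cabs ((z + h) ^+ n - z ^+ n - h * (n%:R * z ^+ n.-1)) <=
    4 * n%:R ^+ 2 * r ^+ n * cabs h ^+ 2.
Proof.
move=> r2 zr zhr; have r0 : 0 <= r by lra.
elim: n => [|n IH].
  by rewrite !expr0 subrr mul0r mulr0 subr0 cabs0 expr0n/= !mulr0 !mul0r.
have -> : (z + h) ^+ n.+1 - z ^+ n.+1 - h * (n.+1%:R * z ^+ n.+1.-1) =
    (z + h) * ((z + h) ^+ n - z ^+ n - h * (n%:R * z ^+ n.-1)) +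
    h ^+ 2 * (n%:R * z ^+ n.-1).
  case: n {IH} => [|n] /=; first by rewrite !expr0 !expr1; ring.
  by rewrite !exprS -(addn1 n.+1) natrD; ring.
rewrite (le_trans (cabsD _ _))// !cabsM cabs_nat !cabsX.
have h1 : cabs (z + h) * cabs ((z + h) ^+ n - z ^+ n - h * (n%:R * z ^+ n.-1)) <=
    r * (4 * n%:R ^+ 2 * r ^+ n * cabs h ^+ 2).
  by apply: ler_pM => //; exact: cabs_ge0.
have h2 : n%:R * cabs z ^+ n.-1 <= 4 * n%:R * r ^+ n.+1.
  case: n {IH h1} => [|n]; first by rewrite mul0r mulr0 mul0r.
  have zn : cabs z ^+ n <= r ^+ n by rewrite lerXn2r// nnegrE cabs_ge0.
  have rr : 1 <= 4 * (r * r) by nra.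
  rewrite (_ : 4 * n.+1%:R * r ^+ n.+2 = n.+1%:R * (r ^+ n * (4 * (r * r)))).
    rewrite ler_wpM2l//= (le_trans zn)// ler_peMr// exprn_ge0//.
  by rewrite !exprS; ring.
have h3 : cabs h ^+ 2 * (n%:R * cabs z ^+ n.-1) <= cabs h ^+ 2 * (4 * n%:R * r ^+ n.+1).
  by rewrite ler_wpM2l// sqr_ge0.
rewrite (le_trans (lerD h1 h3))//.
rewrite (_ : _ + _ = 4 * (n%:R ^+ 2 + n%:R) * r ^+ n.+1 * cabs h ^+ 2); last first.
  by rewrite (exprS r n); ring.
rewrite ler_wpM2r ?sqr_ge0// ler_wpM2r ?exprn_ge0// ler_wpM2l//.
have n0 : 0 <= n%:R :> R by [].
by rewrite -(natr1 n); nra.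
Qed.

Lemma cabs_lacunary_term k z : cabs (lacunary_term k z) = 100 ^+ k * cabs z ^+ (32 ^ k).
Proof. by rewrite cabsM !cabsX cabs_nat. Qed.

Lemma lacunary_term_bound (r A : R) : 0 <= r ->
  (forall k, 100 ^+ k * (32 ^ k)%:R ^+ 2 * r ^+ (32 ^ k) <= A * 2 ^- k) ->
  forall z, cabs z <= r -> forall k, cabs (lacunary_term k z) <= A * 2 ^- k.
Proof.
move=> r0 AP z zr k; rewrite (le_trans _ (AP k))// cabs_lacunary_term.
rewrite -mulrA ler_wpM2l ?exprn_ge0//.
have zk : cabs z ^+ (32 ^ k) <= r ^+ (32 ^ k) by rewrite lerXn2r// nnegrE cabs_ge0.
rewrite (le_trans zk)// ler_peMl ?exprn_ge0//.
by rewrite -natrX ler1n expn_gt0 expn_gt0.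
Qed.

Lemma lacunary_term'_bound (r A : R) : 1 / 2 <= r ->
  (forall k, 100 ^+ k * (32 ^ k)%:R ^+ 2 * r ^+ (32 ^ k) <= A * 2 ^- k) ->
  forall z, cabs z <= r -> forall k, cabs (lacunary_term' k z) <= 2 * A * 2 ^- k.
Proof.
move=> r2 AP z zr k; have r0 : 0 <= r by lra.
rewrite -mulrA (le_trans _ (ler_wpM2l _ (AP k)))// !cabsM !cabsX !cabs_nat.
rewrite [X in _ <= X](_ : _ =
  100 ^+ k * (2 * ((32 ^ k)%:R ^+ 2 * r ^+ (32 ^ k)))); last by ring.
rewrite ler_wpM2l ?exprn_ge0//.
have : (0 < 32 ^ k)%N by rewrite expn_gt0.
case: (32 ^ k)%N => // n _ /=.
have zk : cabs z ^+ n <= r ^+ n by rewrite lerXn2r// nnegrE cabs_ge0.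
have rn : r ^+ n <= 2 * r ^+ n.+1.
  by rewrite exprS mulrA ler_peMl ?exprn_ge0//; lra.
have n1 : 1 <= n.+1%:R :> R by rewrite ler1n.
rewrite (le_trans (_ : _ <= n.+1%:R * (2 * r ^+ n.+1))).
- by [].
- by rewrite ler_wpM2l// (le_trans zk).
rewrite mulrCA ler_wpM2l// ler_wpM2r ?exprn_ge0// expr2.
by rewrite ler_peMr.
Qed.

(** Summing the Taylor estimates of the monomials: differentiability of the sum,
with the termwise derivative. *)
Lemma lacunary_taylor (z h : C) (r A : R) : 1 / 2 <= r -> 0 <= A ->
  (forall k, 100 ^+ k * (32 ^ k)%:R ^+ 2 * r ^+ (32 ^ k) <= A * 2 ^- k) ->
  cabs z <= r -> cabs (z + h) <= r ->
  cabs (lacunary (z + h) - lacunary z - h * lacunary' z) <= 8 * A * cabs h ^+ 2.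
Proof.
move=> r2 A0 AP zr zhr; have r0 : 0 <= r by lra.
apply: (@le_geometric_error _ _ (4 * A + 4 * A + cabs h * (4 * (2 * A)))) => n.
have e1 := csum_tail (lacunary_term_bound r0 AP zhr) n.
have e2 := csum_tail (lacunary_term_bound r0 AP zr) n.
have e3 := csum_tail (lacunary_term'_bound r2 AP zr) n.
rewrite -/(lacunary _) in e1; rewrite -/(lacunary _) in e2.
rewrite -/(lacunary' _) in e3.
set s1 := \sum_(k < n) _ in e1; set s2 := \sum_(k < n) _ in e2.
set s3 := \sum_(k < n) _ in e3.
have e4 : cabs (s1 - s2 - h * s3) <= 8 * A * cabs h ^+ 2.
  have -> : s1 - s2 - h * s3 = \sum_(k < n) (lacunary_term k (z + h) -
      lacunary_term k z - h * lacunary_term' k z).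
    by rewrite mulr_sumr -!sumrB.
  rewrite (le_trans (cabs_sum _ _ _))//.
  rewrite (le_trans (_ : _ <= \sum_(k < n) (4 * A * cabs h ^+ 2) * 2 ^- k))//.
    apply: ler_sum => k _.
    have -> : lacunary_term k (z + h) - lacunary_term k z - h * lacunary_term' k z =
        100 ^+ k * ((z + h) ^+ (32 ^ k) - z ^+ (32 ^ k) -
                   h * ((32 ^ k)%:R * z ^+ (32 ^ k).-1)).
      by rewrite /lacunary_term /lacunary_term'; ring.
    rewrite cabsM cabsX cabs_nat.
    have := cabs_taylor_monomial (32 ^ k) r2 zr zhr.
    move=> /(ler_wpM2l (exprn_ge0 k (ler0n R 100))) /le_trans; apply.
    have := ler_wpM2r (sqr_ge0 (cabs h)) (ler_wpM2l (ler0n R 4) (AP k)).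
    by congr (_ <= _); ring.
  rewrite -mulr_sumr (_ : 8 * A * cabs h ^+ 2 = 4 * A * cabs h ^+ 2 * 2); last by ring.
  by apply: ler_wpM2l; [rewrite mulr_ge0 ?sqr_ge0// mulr_ge0|exact: sum_half].
have split_error (x1 x2 x3 y1 y2 y3 : C) : x1 - x2 - h * x3 =
   (y1 - y2 - h * y3) + ((x1 - y1) - (x2 - y2) - h * (x3 - y3)) by ring.
rewrite (split_error _ _ _ s1 s2 s3).
rewrite (le_trans (cabsD _ _))// lerD//.
rewrite (le_trans (cabsD _ _))// cabsN cabsM (mulrDl (4 * A + 4 * A)) (mulrDl (4 * A)).
apply: lerD; last by rewrite -mulrA ler_wpM2l ?cabs_ge0.
by apply: (le_trans (cabsD _ _)); rewrite cabsN; exact: (lerD e1 e2).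
Qed.

Lemma lacunary_holomorphic : holomorphic_on (unit_disk R) lacunary.
Proof.
move=> z; rewrite /unit_disk/= normE ltcR => z1.
have z0 := cabs_ge0 z.
pose d : R := (1 - cabs z) / 2; pose r : R := (1 + cabs z) / 2.
have d0 : 0 < d by rewrite /d; lra.
have r0 : 0 <= r by rewrite /r; lra.
have r1 : r < 1 by rewrite /r; lra.
have [A A0 AP] := lacunary_majorant r0 r1.
apply/cvg_ex; exists (lacunary' z : C^o).
apply/(@cvgrPdist_le C C^o) => e e0.
pose e' := complex.Re e.
have eE : e = e'%:C by exact/ge0_real/ltW.
have e'0 : 0 < e' by rewrite -ltcR -eE.
have A8 : 0 < 8 * A + 1 by rewrite ltr_wpDl// mulr_ge0.
have small (t : R) : 0 < t -> \forall h \near 0^'%classic, `|h : C^o| <= t%:C.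
  by move=> t0; apply: (@dnbhs0_le C C^o); rewrite ltcR.
near=> h.
have h0 : h != 0 by near: h; exact: (@nbhs_dnbhs_neq C^o).
have hd : cabs h <= d.
  by rewrite -lecR -normE; near: h; exact: small.
have hA : cabs h <= e' / (8 * A + 1).
  by rewrite -lecR -normE; near: h; apply: small; exact: divr_gt0.
rewrite eE normE lecR /= /GRing.scale/= mulr1 [h + z]addrC.
have quotient (x y : C) : x - h^-1 * y = - (h^-1 * (y - h * x)).
  by rewrite mulrBr mulKf// opprB.
rewrite quotient.
have hpos : 0 < cabs h.
  by rewrite lt_neqAle cabs_ge0 andbT eq_sym -(inj_eq (@complexI R)) -normE normr_eq0.
have hV : cabs h^-1 = (cabs h)^-1.
  by apply: (@complexI R); rewrite fmorphV -!normE normfV.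
rewrite cabsN cabsM hV mulrC ler_pdivrMr//.
rewrite (le_trans (@lacunary_taylor z h r A _ A0 AP _ _))//.
- by rewrite /r; lra.
- by rewrite /r; lra.
- by rewrite (le_trans (cabsD _ _))// /r; move: hd; rewrite /d; lra.
rewrite expr2 mulrA ler_wpM2r ?cabs_ge0//.
move: hA; rewrite ler_pdivlMr// => hA.
by have := cabs_ge0 h; nra.
Unshelve. all: by end_near. Qed.

Lemma bernoulli_ge (a : R) n : 0 <= a <= 1 -> 1 - n%:R * a <= (1 - a) ^+ n.
Proof.
move=> /andP[a0 a1]; elim: n => [|n IH]; first by rewrite mul0r subr0.
rewrite exprS -(natr1 n); have n0 : 0 <= n%:R :> R by [].
have := ler_wpM2l (_ : 0 <= 1 - a) IH; rewrite subr_ge0 => /(_ a1); nra.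
Qed.

Lemma bernoulli_addr_ge (a : R) n : 0 <= a -> 1 + n%:R * a <= (1 + a) ^+ n.
Proof.
move=> a0; elim: n => [|n IH]; first by rewrite mul0r addr0.
rewrite exprS -(natr1 n); have n0 : 0 <= n%:R :> R by [].
have := ler_wpM2l (_ : 0 <= 1 + a) IH; rewrite addr_ge0// => /(_ isT); nra.
Qed.

Lemma annulus_power_bounds (x : R) (q : nat) : (0 < q)%N ->
  1 - (2 * q%:R)^-1 <= x <= 1 - (4 * q%:R)^-1 ->
  1 / 2 <= x ^+ q /\ x ^+ q ^+ 32 <= 1 / 1000.
Proof.
move=> q0 /andP[xl xu]; have Q0 : 0 < q%:R :> R by rewrite ltr0n.
have Q1 : 1 <= q%:R :> R by rewrite ler1n.
have x0 : 0 <= x.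
  rewrite (le_trans _ xl)// subr_ge0 invf_le1 ?mulr_gt0//; lra.
pose a : R := (4 * q%:R)^-1.
have qa : q%:R * a = 1 / 4 by rewrite /a; field; rewrite gt_eqF.
have a0 : 0 <= a by rewrite invr_ge0 mulr_ge0.
split.
  rewrite (@le_trans _ _ ((1 - (2 * q%:R)^-1) ^+ q))//.
    rewrite (le_trans _ (bernoulli_ge _ _))//.
      by rewrite le_eqVlt; apply/orP; left; apply/eqP; field; rewrite gt_eqF.
    by rewrite invr_ge0 mulr_ge0//= invf_le1 ?mulr_gt0//; lra.
  rewrite lerXn2r// nnegrE subr_ge0 invf_le1 ?mulr_gt0//; lra.
have y0 : 0 <= x ^+ q by exact: exprn_ge0.
have y1 : x ^+ q * (5 / 4) <= 1.
  rewrite (@le_trans _ _ (x ^+ q * (1 + a) ^+ q))//.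
    rewrite ler_wpM2l// (le_trans _ (bernoulli_addr_ge q a0))// qa; lra.
  rewrite -exprMn exprn_ile1// ?mulr_ge0 ?addr_ge0//.
  have : x <= 1 - a by [].
  nra.
have {y0 y1} : 0 <= x ^+ q <= 4 / 5 by rewrite y0/=; lra.
move: (x ^+ q) => y /andP[y0 y1].
(* Five squarings bring [4/5] below [1/1000]. *)
have sq (u c d : R) : 0 <= u -> u <= c -> c ^+ 2 <= d -> 0 <= u ^+ 2 /\ u ^+ 2 <= d.
  by move=> u0 uc cd; split; nra.
rewrite (_ : 32 = 2 * (2 * (2 * (2 * 2))))%N// !exprM.
have [a1 b1] := sq y _ (16 / 25) y0 y1 ltac:(lra).
have [a2 b2] := sq _ _ (41 / 100) a1 b1 ltac:(lra).
have [a3 b3] := sq _ _ (17 / 100) a2 b2 ltac:(lra).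
have [a4 b4] := sq _ _ (29 / 1000) a3 b3 ltac:(lra).
by have [a5 b5] := sq _ _ (1 / 1000) a4 b4 ltac:(lra).
Qed.

Lemma sum_geometric_below k : \sum_(j < k) 100 ^+ j <= 100 ^+ k / 99 :> R.
Proof.
elim: k => [|k IH]; first by rewrite big_ord0 divr_ge0.
rewrite big_ord_recr/= exprS.
have := exprn_ge0 k (ler0n R 100); lra.
Qed.

Lemma sum_geometric_above (t : R) m : 0 <= t <= 1 / 1000 ->
  \sum_(i < m) 100 ^+ i.+1 * t ^+ i.+1 <= 1 / 9.
Proof.
move=> /andP[t0 t1].
rewrite (@le_trans _ _ (\sum_(i < m) (1 / 10) ^+ i.+1))//.
  by apply: ler_sum => i _; rewrite -exprMn lerXn2r// ?nnegrE ?mulr_ge0//; lra.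
suff : \sum_(i < m) (1 / 10) ^+ i.+1 = (1 - (1 / 10) ^+ m) / 9 :> R.
  move=> ->; have := exprn_ge0 m (_ : 0 <= 1 / 10 :> R).
  by rewrite divr_ge0// => /(_ isT); lra.
elim: m => [|m IH]; first by rewrite big_ord0 expr0 subrr mul0r.
by rewrite big_ord_recr/= IH exprS; field.
Qed.

(** On this annulus [|z|^(32^k)] is between [1/2] and [4/5]. The earlier terms are
together at most [100^k / 99], since there [|z| < 1], and the later ones at most
[100^k / 9], since [|z|^(32^(k+1)) <= 1/1000]; what remains of [100^k / 2]
exceeds [100^k / 4]. *)
Lemma lacunary_ge k z :
  1 - (2 * (32 ^ k)%:R)^-1 <= cabs z <= 1 - (4 * (32 ^ k)%:R)^-1 ->
  100 ^+ k / 4 <= cabs (lacunary z).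
Proof.
move=> zk; have q0 : (0 < 32 ^ k)%N by rewrite expn_gt0.
have [yl yu] := annulus_power_bounds q0 zk.
have Q0 : 0 < (32 ^ k)%:R :> R by rewrite ltr0n.
have z1 : cabs z < 1.
  have /andP[_ /le_lt_trans] := zk; apply.
  by rewrite gtrBl invr_gt0 mulr_gt0.
have z0 := cabs_ge0 z.
have [A A0 AP] := lacunary_majorant z0 z1.
have e100 := exprn_ge0 k (ler0n R 100).
apply: (@le_geometric_error _ _ (4 * A)) => n.
have := csum_tail (lacunary_term_bound z0 AP (lexx _)) (k.+1 + n).
rewrite -/(lacunary z) big_split_ord/= big_ord_recr/=.
set s1 := \sum_(i < k) _; set s2 := \sum_(i < n) _ => tl.
have b1 : cabs s1 <= 100 ^+ k / 99.
  rewrite (le_trans (cabs_sum _ _ _))// (le_trans _ (sum_geometric_below k))//.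
  apply: ler_sum => j _; rewrite cabs_lacunary_term ler_piMr ?exprn_ge0//.
  by rewrite exprn_ile1// ltW.
have b2 : cabs s2 <= 100 ^+ k * (1 / 9).
  rewrite (le_trans (cabs_sum _ _ _))//.
  have t01 : 0 <= cabs z ^+ (32 ^ k) ^+ 32 <= 1 / 1000.
    by rewrite yu andbT !exprn_ge0.
  apply: le_trans (ler_wpM2l e100 (sum_geometric_above n t01)).
  rewrite mulr_sumr; apply: ler_sum => i _; rewrite cabs_lacunary_term/=.
  rewrite addSn -addnS exprD -mulrA ler_wpM2l// ler_wpM2l ?exprn_ge0//.
  rewrite -!exprM; apply: ler_wiXn2l => //; first exact: ltW.
  rewrite expnD (expnS _ i) leq_mul2l; apply/orP; right.
  by rewrite leq_mul2l/= ltn_expl.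
have b3 : 100 ^+ k * (1 / 2) <= cabs (lacunary_term k z).
  by rewrite cabs_lacunary_term ler_wpM2l.
have {}tl : cabs (lacunary z - (s1 + lacunary_term k z + s2)) <= 4 * A * 2 ^- n.
  apply: (le_trans tl); rewrite ler_wpM2l ?mulr_ge0//.
  rewrite lef_pV2 ?posrE ?exprn_gt0//.
  by rewrite ler_weXn2l// ?ler1n// leq_addl.
have split_error (l u v w : C) : v = l - (l - (u + v + w)) - u - w by ring.
have := cabsD (lacunary z - (lacunary z - (s1 + lacunary_term k z + s2)) - s1) (- s2).
rewrite -split_error cabsN.
have := cabsD (lacunary z - (lacunary z - (s1 + lacunary_term k z + s2))) (- s1).
rewrite cabsN.
have := cabsD (lacunary z) (- (lacunary z - (s1 + lacunary_term k z + s2))).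
rewrite cabsN.
move: b1 b2 b3 tl.
move: (cabs _) (cabs _) (cabs _) (cabs _) (cabs _) (cabs _) (cabs _) => *; lra.
Qed.

End Lacunary.
End LacunarySeries.

(** * A variation of Hodge structure without harmonic metric *)

Section Assembly.
Variable R : realType.
Local Notation C := R[i].

Lemma Ck_on_c1 k (U : set C) f z : Ck_on k.+1 U f -> U z -> c1 f z.
Proof.
case=> fc [fd _ _] Uz; split; first exact: fc.
have [d1 d2] := fd z Uz.
by exists (dz f z), (dzbar f z); exact: rderivable_has_wirt.
Qed.

Lemma smooth_mxc1 n (U : set C) (H : C -> 'M[C]_n) z :
  mx_smooth_on U H -> U z -> mxc1 H z.
Proof. by move=> Hs Uz i j; exact: (Ck_on_c1 (Hs i j 1%N)). Qed.

Lemma smooth_mxc1_dz n (U : set C) (H : C -> 'M[C]_n) z :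
  mx_smooth_on U H -> U z -> mxc1 (mx_dz H) z.
Proof.
move=> Hs Uz i j; have [_ [_ d1 d2]] := Hs i j 2%N.
under eq_fun do rewrite mxE.
apply: c1M; last exact: c1_cst.
apply: c1D; first exact: (@Ck_on_c1 0 U _ z d1 Uz).
have := c1M (c1_cst (- 'i%C) z) (@Ck_on_c1 0 U _ z d2 Uz).
by under eq_fun do rewrite mulNr.
Qed.

Definition shift_mx n : 'M[C]_n := \matrix_(i, j) (i == j.+1 :> nat)%:R.

Lemma shift_mx_eigenvalue n a : eigenvalue (shift_mx n) a -> a = 0.
Proof.
rewrite eigenvalue_root_char char_poly_trig.
  rewrite (eq_bigr (fun=> 'X)).
    rewrite prodr_const => /rootP; rewrite hornerXn => /eqP.
    by rewrite expf_eq0 => /andP[_ /eqP].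
  by move=> i _; rewrite mxE ltn_eqF// subr0.
by apply/is_trig_mxP => i j ij; rewrite mxE ltn_eqF// ltnW.
Qed.

Lemma shift_mxX n k (i j : 'I_n.+1) :
  (shift_mx n.+1 ^+ k) i j = (i == (j + k)%N :> nat)%:R.
Proof.
elim: k i j => [|k IH] i j; first by rewrite expr0 mxE addn0.
rewrite exprSr mxE.
have [jn|jn] := ltnP j.+1 n.+1.
  rewrite (bigD1 (Ordinal jn))//= IH !mxE/= eqxx mulr1 big1 ?addr0 ?addSnnS//.
  move=> l lj; rewrite mxE [_ == j.+1](_ : _ = false) ?mulr0//.
  by apply: contraNF lj => /eqP lj; apply/eqP/val_inj.
rewrite big1 => [|l _]; last first.
  by rewrite mxE (ltn_eqF (leq_trans (ltn_ord l) jn)) mulr0.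
rewrite (ltn_eqF (leq_trans (ltn_ord i) _))// (leq_trans jn)// addnS ltnS leq_addr//.
Qed.

Lemma shift_mxX_neq0 n : shift_mx n.+1 ^+ n != 0.
Proof.
apply/eqP => /matrixP/(_ ord_max ord0); rewrite shift_mxX mxE add0n eqxx.
by move/eqP; rewrite oner_eq0.
Qed.

Lemma hnormX n (H S : 'M[C]_n.+1) k : posdef H ->
  hnorm H (S ^+ k.+1) <= hnorm H S ^+ k.+1.
Proof.
move=> Hp; elim: k => [|k IH]; first by rewrite !expr1.
rewrite exprS [leRHS]exprS (le_trans (hnormM Hp _ _))//.
by rewrite ler_wpM2l// hnorm_ge0.
Qed.

Lemma hnormZ n (H S : 'M[C]_n) a : hnorm H (a *: S) = `|a| ^+ 2 * hnorm H S.
Proof.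
rewrite /hnorm /adjoint trmxCZ -!(scalemxAl, scalemxAr) !mxtraceZ mulrA.
by rewrite normCK.
Qed.

Lemma adjointZ n (H S : 'M[C]_n) a :
  adjoint H (a *: S) = Num.conj a *: adjoint H S.
Proof. by rewrite /adjoint trmxCZ -!(scalemxAl, scalemxAr). Qed.

Lemma unit_disk_open : open (unit_disk R : set C^o).
Proof.
rewrite (_ : (unit_disk R : set C) = [set w | `|w - 0| < 1%:C]); first exact: open_disc.
by apply/seteqP; split => z; rewrite /unit_disk/= subr0.
Qed.

Section NoHarmonicMetric.
Variables (n : nat) (H : C -> 'M[C]_n.+2).
Local Notation D := (unit_disk R).
Local Notation N := (shift_mx n.+2).
Hypothesis Hpos : forall z, D z -> posdef (H z).
Hypothesis H_c1 : forall z, D z -> mxc1 H z.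
Hypothesis dH_c1 : forall z, D z -> mxc1 (mx_dz H) z.
Hypothesis harm : forall z, D z -> let T := lacunary z *: N in
  curvature (chern_form H) z +
  (T *m adjoint (H z) T - adjoint (H z) T *m T) = 0.

Let unit_diskE z : D z <-> cabs z < 1.
Proof. by rewrite /unit_disk/= normE ltcR. Qed.

Let comm k z : N ^+ k *m (lacunary z *: N) = (lacunary z *: N) *m N ^+ k.
Proof.
by rewrite -scalemxAr -scalemxAl -[_ *m _]exprSr -[N *m _]exprS.
Qed.

Let kappa : R := \sum_(i < n.+2) i%:R ^+ 2.

Let kappa_gt0 : 0 < kappa.
Proof.
rewrite /kappa (bigD1 ord_max)//=; apply: ltr_pwDl; first by rewrite exprn_gt0.
by apply: sumr_ge0 => i _; rewrite exprn_ge0.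
Qed.

(** Simpson's a priori estimate on a disc. As [N] is nilpotent, [|[N^*, N]|^2] is at
least [|N|^4 / kappa], so Bochner's formula makes [|N|^2] a solution of the
differential inequality of the Ahlfors-Schwarz lemma. *)
Lemma hnorm_shift_mx_le p (e M : R) : 0 < e -> 0 < M ->
  (forall w, `|w - p| <= e%:C -> D w /\ M <= cabs (lacunary w) ^+ 2) ->
  M * complex.Re (hnorm (H p) N) * e ^+ 2 <= 2 * kappa.
Proof.
move=> e0 M0 eM.
have bo := bochner unit_disk_open Hpos H_c1 dH_c1 harm (S := N)
  (fun z _ => comm 1 z).
suff h : M / kappa * complex.Re (hnorm (H p) N) * e ^+ 2 <= 2.
  rewrite -ler_pdivrMr//; apply: le_trans h.
  by rewrite le_eqVlt; apply/orP; left; apply/eqP; ring.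
apply: (@ahlfors_schwarz R D (fun z => hnorm (H z) N) (dz_hnorm H N)).
- exact: e0.
- exact: divr_gt0.
- by move=> w /eM[].
- by move=> w /Hpos/hnorm_ge0.
- by move=> w /bo[].
- move=> w /eM[Dw Mw]; have [_ _ [a [b [ab _ ineq]]]] := bo w Dw; exists a, b; split=> //.
  apply: le_trans ineq; rewrite lerD2l exprS mulrCA; apply: ler_wpM2l;
    first exact: hnorm_ge0 (Hpos Dw) _.
  rewrite adjointZ -scalemxAl -scalemxAr -scalerBr hnormZ norm_conjC.
  set X := hnorm (H w) (_ - _).
  have X0 : 0 <= X by exact: hnorm_ge0 (Hpos Dw) _.
  have kE : \sum_(i < n.+2) i%:R ^+ 2 = kappa%:C.
    by rewrite /kappa rmorph_sum; apply: eq_bigr => i _; rewrite rmorphXn rmorph_nat.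
  have := hnorm_self_commutator (Hpos Dw) (@shift_mx_eigenvalue _).
  rewrite -/X kE => fX.
  have k0 : 0 < kappa%:C by rewrite ltcR.
  clearbody X; move: (hnorm (H w) N ^+ 2) fX => f2 fX.
  have kV : (M / kappa)%:C = M%:C / kappa%:C.
    by rewrite real_complexM; congr (_ * _); exact: fmorphV.
  have ML : M%:C <= `|lacunary w| ^+ 2 by rewrite normE -rmorphXn lecR.
  apply: (le_trans _ (ler_wpM2r X0 ML)).
  rewrite kV -mulrA; apply: ler_wpM2l; first by rewrite lecR ltW.
  by rewrite mulrC (ler_pdivrMr _ _ k0) [X * _]mulrC.
Qed.

(** The function [F = |N^(n+1)|^2] is subharmonic and positive at the origin. On the
circle of radius [r], in the middle of the [k]-th annulus of [lacunary_ge], it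
is at most the power [n + 1] of [|N|^2], which tends to zero with [k]. *)
Lemma no_harmonic_shift_mx : False.
Proof.
pose S := N ^+ n.+1; pose F z := hnorm (H z) S.
have bo := bochner unit_disk_open Hpos H_c1 dH_c1 harm (S := S)
  (fun z _ => comm n.+1 z).
have D0 : D 0 by apply/unit_diskE; rewrite cabs0.
have F0 : 0 < complex.Re (F 0).
  have := hnorm_gt0 (Hpos D0) (@shift_mxX_neq0 n.+1).
  by rewrite ltcE => /andP[_].
(* The estimate on discs of radius [1 / (8 * 32^k)], where [|lacunary|^2] is at
   least [(100^k / 4)^2], gives the bound [2048 * kappa * (32 / 100)^(2 * k)]. *)
pose beta k : R := 2048 * kappa * 2 ^- k.
have [k bk1 bkF] : exists2 k, beta k <= 1 & beta k < complex.Re (F 0).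
  apply: contrapT => nk.
  have m0 : 0 < Num.min 1 (complex.Re (F 0)) by rewrite lt_min ltr01.
  have := m0; rewrite ltNge => /negP; apply.
  apply: (@le_geometric_error _ _ _ (2048 * kappa)) => k; rewrite add0r.
  rewrite leNgt; apply/negP; rewrite lt_min => /andP[b1 bF].
  by apply: nk; exists k => //; exact: ltW.
move: bkF; rewrite ltNge => /negP; apply.
pose Q : R := (32 ^ k)%:R.
have Q1 : 1 <= Q by rewrite ler1n expn_gt0.
pose e : R := (8 * Q)^-1.
have eQ : e * Q = 1 / 8 by rewrite /e; field; rewrite gt_eqF//; lra.
have e0 : 0 < e by rewrite invr_gt0; lra.
have e8 : e <= 1 / 8 by nra.
pose r : R := 1 - 3 * e.
have r0 : 0 < r by rewrite /r; lra.
pose M : R := (100 ^+ k / 4) ^+ 2.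
have M0 : 0 < M by rewrite exprn_gt0// divr_gt0// exprn_gt0.
apply: (@subharmonic_le R D F (dz_hnorm H S) r (beta k) r0).
- move=> w; rewrite normE lecR => wr; apply/unit_diskE.
  by rewrite (le_lt_trans wr)// /r; lra.
- move=> w Dw; have [c1F dF [a [b [ab b0 _]]]] := bo w Dw.
  by split=> //; exists a, b.
move=> p; rewrite normE => /complexI pr.
have Dp : D p by apply/unit_diskE; rewrite pr /r; lra.
have fp0 := hnorm_ge0 (Hpos Dp) N.
have fpE := ge0_real fp0.
have f0 : 0 <= complex.Re (hnorm (H p) N) by rewrite -lecR -fpE.
have fle : complex.Re (hnorm (H p) N) <= beta k.
  have : M * complex.Re (hnorm (H p) N) * e ^+ 2 <= 2 * kappa.
    apply: hnorm_shift_mx_le => // w; rewrite normE lecR => wp.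
    have h1 : cabs w <= r + e.
      have := cabsD (w - p) p; rewrite subrK pr; lra.
    have h2 : r - e <= cabs w.
      have := cabsD (p - w) w; rewrite subrK pr -cabsN opprB; lra.
    split; first by apply/unit_diskE; rewrite (le_lt_trans h1)// /r; lra.
    rewrite /M lerXn2r ?nnegrE ?cabs_ge0 ?divr_ge0 ?exprn_ge0//.
    apply: lacunary_ge; rewrite -/Q.
    have -> : (2 * Q)^-1 = 4 * e by rewrite /e; field; rewrite gt_eqF//; lra.
    have -> : (4 * Q)^-1 = 2 * e by rewrite /e; field; rewrite gt_eqF//; lra.
    apply/andP; split; [move: h2|move: h1]; rewrite /r; lra.
  move=> h; have Me : 2 ^+ k <= 1024 * (M * e ^+ 2).
    have -> : 1024 * (M * e ^+ 2) = (100 ^+ k) ^+ 2 / Q ^+ 2.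
      by rewrite /M /e; field; rewrite gt_eqF//; lra.
    rewrite ler_pdivlMr ?exprn_gt0//; last by lra.
    rewrite /Q natrX !(exprAC _ k) -exprMn lerXn2r ?nnegrE//; lra.
  rewrite /beta ler_pdivlMr ?exprn_gt0//.
  apply: (le_trans (ler_wpM2l f0 Me)).
  by move: h; move: (complex.Re _) => x h; lra.
have FX := @hnormX n.+1 (H p) N n (Hpos Dp).
rewrite -/(F p) fpE -rmorphXn lecE in FX; move: FX => /andP[_] /le_trans; apply.
apply: (le_trans _ fle); rewrite [complex.Re _]/= exprS; apply: ler_piMr => //.
by apply: exprn_ile1 => //; exact: le_trans fle bk1.
Qed.

End NoHarmonicMetric.
Section Construction.
Local Notation D := (unit_disk R).

Lemma unit_disk_cover : \bigcup_(a : unit) D = D.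
Proof. by apply/seteqP; split => [z [] //|z Dz]; exists tt. Qed.

Definition disk_cover : open_cover D :=
  OpenCover (fun _ : unit => unit_disk_open) unit_disk_cover.

Lemma mx_holomorphic_cst m p (A : 'M[C]_(m, p)) (U : set C) :
  mx_holomorphic_on U (fun=> A).
Proof. by move=> i j z _; exact: derivable_cst. Qed.

Definition trivial_line : line_bundle disk_cover :=
  @VectorBundle R D disk_cover 1 (fun _ _ _ => 1%:M)
    (fun a b => @mx_holomorphic_cst 1 1 1%:M (disk_cover a `&` disk_cover b))
    (fun a z _ => erefl) (fun a b c z _ _ _ => mul1mx 1%:M).

Lemma lacunary_scalar_holomorphic (a : chart_index disk_cover) :
  mx_holomorphic_on (disk_cover a) (fun z => (lacunary z)%:M : 'M[C]_1).
Proof.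
move=> i j z Dz.
rewrite (_ : (fun _ => _) = @lacunary R); first exact: lacunary_holomorphic.
by apply/funext => w; rewrite !ord1 mxE eqxx mulr1n.
Qed.

Lemma lacunary_compat (a b : chart_index disk_cover) z :
  disk_cover a z -> disk_cover b z ->
  (lacunary z)%:M *m transition trivial_line a b z =
  transition trivial_line a b z *m (lacunary z)%:M.
Proof. by move=> _ _; rewrite mul1mx mulmx1. Qed.

Definition lacunary_hom : bundle_hom trivial_line trivial_line :=
  BundleHom lacunary_scalar_holomorphic lacunary_compat.

Lemma lacunary_hom_neq0 : hom_not_identically_zero lacunary_hom.
Proof.
exists tt, (1 / 2)%:C; split.
  by rewrite /= /unit_disk/= normc_def/= expr0n/= addr0 sqrtr_sqr ltcR gtr0_norm; lra.
have h : cabs ((1 / 2)%:C : C) = 1 / 2.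
  by rewrite /cabs normc_def/= expr0n/= addr0 sqrtr_sqr gtr0_norm; lra.
have := @lacunary_ge R 0 (1 / 2)%:C; rewrite h expn0 expr0 => /(_ _) l.
apply/eqP => /matrixP/(_ 0 0); rewrite !mxE eqxx mulr1n => l0.
have : 1 / 4 <= cabs (lacunary ((1 / 2)%:C : C)).
  by apply: l; apply/andP; split; lra.
by rewrite l0 cabs0; lra.
Qed.

Definition lacunary_cvhs n : cvhs D n :=
  @CVHS R D n disk_cover (fun=> trivial_line) (fun=> lacunary_hom)
    (fun=> lacunary_hom_neq0).

Lemma lacunary_theta n z :
  @cvhs_theta R D n (lacunary_cvhs n) tt z = lacunary z *: shift_mx n.
Proof.
apply/matrixP => i j; rewrite [RHS]mxE [in RHS]mxE summxE.
transitivity (\sum_(k < n.-1) lacunary z * ((i == tgt k) && (j == src k))%:R).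
  by apply: eq_bigr => k _; rewrite !mxE eqxx mulr1n.
rewrite -mulr_sumr; congr (_ * _).
have [ij|ij] := eqVneq (i : nat) j.+1.
  have jn : (j < n.-1)%N by rewrite ltn_predRL -ij.
  rewrite (bigD1 (Ordinal jn))//= big1 => [|k kj].
    have -> : i == tgt (Ordinal jn) by apply/eqP/val_inj.
    have -> : j == src (Ordinal jn) by apply/eqP/val_inj.
    by rewrite addr0.
  rewrite [j == _](_ : _ = false) ?andbF//.
  by apply: contraNF kj => /eqP jk; apply/eqP/val_inj; rewrite /= jk.
rewrite big1// => k _; rewrite [_ && _](_ : _ = false)//.
apply/negP => /andP[/eqP ik /eqP jk]; move: ij; rewrite ik jk/= eqxx//.
Qed.

End Construction.
End Assembly.

Theorem proposition6p9 (R : realType) (n : nat) (hn : (2 <= n)%N) :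
  exists E : cvhs (unit_disk R) n, ~ admits_harmonic_metric (cvhs_higgs E).
Proof.
case: n hn => [//|[//|n _]].
exists (lacunary_cvhs R n.+2) => -[h harm].
apply: (@no_harmonic_shift_mx R n (metric_mx h tt)).
- by move=> z Dz; split; [exact: metric_hermitian|exact: metric_posdef].
- by move=> z Dz; exact: smooth_mxc1 (metric_smooth h tt) Dz.
- by move=> z Dz; exact: smooth_mxc1_dz (metric_smooth h tt) Dz.
- by move=> z Dz T; have := harm tt z Dz; rewrite /= lacunary_theta.
Qed.
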